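(* Let $(TM,\lambda)$ be an EAP-space. Assume that the CB-condition holds for the canonical $d$-connection: $N^a_\mu=y^b\Gamma^a_{b\mu}$, $y^bC^a_{bc}=0$, $C^\alpha_{\mu c}=0$. Then (with $|$ the $h$-covariant derivative of the canonical $d$-connection): (1) The four defined $d$-connections of the EAP-space (canonical, dual, symmetric, natural metric) coincide up to the $hh$-coefficients. Moreover, these $hh$-coefficients are functions of the positional argument $x$ only and are identical to the coefficients of the corresponding four defined connections in the classical AP-space. (2) The torsion of the canonical $d$-connection and the contortion of the EAP-space are functions of the positional argument $x$ only and are given by $\mathbf T=(\Lambda^\alpha_{\mu\nu},0,0,0,0)$, $\mathbf C=(\gamma^\alpha_{\mu\nu},0,0,0)$. (3) The three non-vanishing curvature tensors are functions of the positional argument $x$ only and are given by (a) $\mathring R^\alpha_{\beta\mu\nu}=(\gamma^\alpha_{\beta\mu|\nu}-\gamma^\alpha_{\beta\nu|\mu})+(\gamma^\epsilon_{\beta\nu}\gamma^\alpha_{\epsilon\mu}-\gamma^\epsilon_{\beta\mu}\gamma^\alpha_{\epsilon\nu})+\gamma^\alpha_{\beta\epsilon}\Lambda^\epsilon_{\mu\nu}$, (b) $\widetilde R^\alpha_{\beta\mu\nu}=\Lambda^\alpha_{\nu\mu|\beta}$, (c) $\widehat R^\alpha_{\beta\mu\nu}=\frac12(\Lambda^\alpha_{\beta\mu|\nu}-\Lambda^\alpha_{\beta\nu|\mu})+\frac14(\Lambda^\epsilon_{\beta\mu}\Lambda^\alpha_{\nu\epsilon}-\Lambda^\epsilon_{\beta\nu}\Lambda^\alpha_{\mu\epsilon})+\frac12\Lambda^\epsilon_{\mu\nu}\Lambda^\alpha_{\beta\epsilon}$.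 (4) There is only one $W$-tensor, which is a function of the positional argument $x$ only and is given by $\widetilde W^\alpha_{\beta\nu\mu}=\Lambda^\alpha_{\nu\mu|\beta}+\Lambda^\epsilon_{\nu\mu}\Lambda^\alpha_{\beta\epsilon}$. All other $W$-tensors vanish identically, or coincide with the corresponding curvature tensors. Consequently, the fundamental geometric objects of the EAP-space coincide with the corresponding fundamental geometric objects of the classical AP-space.
   Context: Let $M$ be a smooth paracompact $n$-manifold, $TM$ its tangent bundle with induced local coordinates $(x^\mu,y^a)$, and $N=(N^a_\mu(x,y))$ a given nonlinear connection on $TM$. Greek indices denote horizontal and Latin indices vertical components; both run over $1,\dots,n$; repeated indices (including the mesh index $i$) are summed. Put $\partial_\mu=\partial/\partial x^\mu$, $\dot\partial_a=\partial/\partial y^a$, $\delta_\mu=\partial_\mu-N^a_\mu\dot\partial_a$ and $R^a_{\mu\nu}=\delta_\nu N^a_\mu-\delta_\mu N^a_\nu$. A $d$-connection is a linear connection $D$ on $TM$ preserving by parallelism the horizontal and the vertical distribution; its coefficients $(\Gamma^\alpha_{\mu\nu},\Gamma^a_{b\nu},C^\alpha_{\mu c},C^a_{bc})$ are defined by $D_{\delta_\nu}\delta_\mu=\Gamma^\alpha_{\mu\nu}\delta_\alpha$, $D_{\delta_\nu}\dot\partial_b=\Gamma^a_{b\nu}\dot\partial_a$, $D_{\dot\partial_c}\delta_\mu=C^\alpha_{\mu c}\delta_\alpha$, $D_{\dot\partial_c}\dot\partial_b=C^a_{bc}\dot\partial_a$. The $\Gamma^\alpha_{\mu\nu}$ are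 its $hh$-coefficients. Its $h$- and $v$-covariant derivatives are $T^{\alpha a}{}_{\beta b|\mu}=\delta_\mu T^{\alpha a}_{\beta b}+T^{\epsilon a}_{\beta b}\Gamma^\alpha_{\epsilon\mu}+T^{\alpha d}_{\beta b}\Gamma^a_{d\mu}-T^{\alpha a}_{\epsilon b}\Gamma^\epsilon_{\beta\mu}-T^{\alpha a}_{\beta d}\Gamma^d_{b\mu}$, $T^{\alpha a}{}_{\beta b||c}=\dot\partial_cT^{\alpha a}_{\beta b}+T^{\epsilon a}_{\beta b}C^\alpha_{\epsilon c}+T^{\alpha d}_{\beta b}C^a_{dc}-T^{\alpha a}_{\epsilon b}C^\epsilon_{\beta c}-T^{\alpha a}_{\beta d}C^d_{bc}$, similarly for other types. Torsion: $\mathbf T=(\Lambda^\alpha_{\mu\nu},R^a_{\mu\nu},C^\alpha_{\mu c},P^a_{\mu c},T^a_{bc})$ with $\Lambda^\alpha_{\mu\nu}=\Gamma^\alpha_{\mu\nu}-\Gamma^\alpha_{\nu\mu}$, $P^a_{\mu c}=\dot\partial_cN^a_\mu-\Gamma^a_{c\mu}$, $T^a_{bc}=C^a_{bc}-C^a_{cb}$. Curvature: $\mathbf R(X,Y)Z=D_XD_YZ-D_YD_XZ-D_{[X,Y]}Z$, with components $\mathbf R(\delta_\mu,\delta_\nu)\delta_\beta=R^\alpha_{\beta\mu\nu}\delta_\alpha$, $\mathbf R(\delta_\mu,\delta_\nu)\dot\partial_b=R^a_{b\mu\nu}\dot\partial_a$, $\mathbf R(\dot\partial_c,\delta_\nu)\delta_\beta=P^\alpha_{\beta\nu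 c}\delta_\alpha$, $\mathbf R(\dot\partial_c,\delta_\nu)\dot\partial_b=P^a_{b\nu c}\dot\partial_a$, $\mathbf R(\dot\partial_b,\dot\partial_c)\delta_\beta=S^\alpha_{\beta bc}\delta_\alpha$, $\mathbf R(\dot\partial_c,\dot\partial_d)\dot\partial_b=S^a_{bcd}\dot\partial_a$. EAP-space $(TM,\lambda)$: $TM$ with $N$ and $n$ vector fields $\lambda_i=\lambda_i^\alpha\delta_\alpha+\lambda_i^a\dot\partial_a$ ($i=1,\dots,n$) defined globally on $TM$ with linearly independent horizontal parts and linearly independent vertical parts. $(\lambda_{i\alpha})$, $(\lambda_{ia})$ are the inverse matrices of $(\lambda_i^\alpha)$, $(\lambda_i^a)$. Metric: $g_{\alpha\beta}=\lambda_{i\alpha}\lambda_{i\beta}$, $g_{ab}=\lambda_{ia}\lambda_{ib}$, with inverses $g^{\alpha\beta}$, $g^{ab}$. The four $d$-connections: natural metric $\mathring D$: $\mathring\Gamma^\alpha_{\mu\nu}=\frac12g^{\alpha\epsilon}(\delta_\mu g_{\epsilon\nu}+\delta_\nu g_{\epsilon\mu}-\delta_\epsilon g_{\mu\nu})$, $\mathring\Gamma^a_{b\nu}=\dot\partial_bN^a_\nu+\frac12g^{ac}(\delta_\nu g_{bc}-g_{dc}\dot\partial_bN^d_\nu-g_{bd}\dot\partial_cN^d_\nu)$, $\mathring C^\alpha_{\mu c}=\frac12g^{\alpha\epsilon}\dot\partial_cg_{\mu\epsilon}$, $\mathring C^a_{bc}=\frac12g^{ad}(\dot\partial_bg_{dc}+\dot\partial_cg_{db}-\dot\partial_dg_{bc})$;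 canonical $D$: $\Gamma^\alpha_{\mu\nu}=\lambda_i^\alpha\delta_\nu\lambda_{i\mu}$, $\Gamma^a_{b\nu}=\lambda_i^a\delta_\nu\lambda_{ib}$, $C^\alpha_{\mu c}=\lambda_i^\alpha\dot\partial_c\lambda_{i\mu}$, $C^a_{bc}=\lambda_i^a\dot\partial_c\lambda_{ib}$; dual $\widetilde D$: $\widetilde\Gamma^\alpha_{\mu\nu}=\Gamma^\alpha_{\nu\mu}$, $\widetilde\Gamma^a_{b\mu}=\Gamma^a_{b\mu}$, $\widetilde C^\alpha_{\mu c}=C^\alpha_{\mu c}$, $\widetilde C^a_{bc}=C^a_{cb}$; symmetric $\widehat D$: $\widehat\Gamma^\alpha_{\mu\nu}=\frac12(\Gamma^\alpha_{\mu\nu}+\Gamma^\alpha_{\nu\mu})$, $\widehat\Gamma^a_{b\mu}=\Gamma^a_{b\mu}$, $\widehat C^\alpha_{\mu c}=C^\alpha_{\mu c}$, $\widehat C^a_{bc}=\frac12(C^a_{bc}+C^a_{cb})$. Decorations on $R,P,S,W$ indicate the connection. Unadorned $\Lambda$, $\mathbf T$ refer to the canonical one. Contortion: $\mathbf C=(\gamma^\alpha_{\mu\nu},\gamma^a_{b\mu},\gamma^\alpha_{\mu c},\gamma^a_{bc})$ = (coefficients of $D$) minus (coefficients of $\mathring D$). $W$-tensors of a $d$-connection (with its own $|$, $||$) are defined by requiring, for every $\lambda=\lambda_i$: $\lambda^\alpha{}_{|\nu|\mu}-\lambda^\alpha{}_{|\mu|\nu}=\lambda^\epsilon W^\alpha_{\epsilon\nu\mu}$;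 $\lambda^a{}_{|\nu|\mu}-\lambda^a{}_{|\mu|\nu}=\lambda^dW^a_{d\nu\mu}$; $\lambda^\alpha{}_{|\nu||c}-\lambda^\alpha{}_{||c|\nu}=\lambda^\epsilon W^\alpha_{\epsilon\nu c}$; $\lambda^a{}_{|\nu||c}-\lambda^a{}_{||c|\nu}=\lambda^dW^a_{d\nu c}$; $\lambda^\alpha{}_{||b||c}-\lambda^\alpha{}_{||c||b}=\lambda^\epsilon W^\alpha_{\epsilon bc}$; $\lambda^a{}_{||c||d}-\lambda^a{}_{||d||c}=\lambda^eW^a_{ecd}$. Classical AP-space: the manifold $M$ with $n$ globally defined linearly independent vector fields $\lambda_i^\alpha(x)\partial_\alpha$, inverse matrix $(\lambda_{i\alpha}(x))$, metric $g_{\mu\nu}=\lambda_{i\mu}\lambda_{i\nu}$, canonical connection $\lambda_i^\alpha\partial_\nu\lambda_{i\mu}$, its dual (lower indices transposed), its symmetric part, and the Levi-Civita connection of $g$; torsion, contortion, curvatures and the $W$-tensor of the dual connection ($\lambda_i^\alpha{}_{\widetilde|\nu\widetilde|\mu}-\lambda_i^\alpha{}_{\widetilde|\mu\widetilde|\nu}=\lambda_i^\epsilon W^\alpha_{\epsilon\nu\mu}$) are defined by the same formulas on $M$. Here it is the one given by the horizontal components $\lambda_i^\alpha$, which under the CB-condition depend on $x$ only.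
   Formalization: In (4) the last factor has its lower indices transposed: the formula proved is W̃^α_{βνμ} = Λ^α_{νμ|β} + Λ^ε_{νμ}Λ^α_{εβ}; the printed sign of the quadratic term is false under the given conventions (e.g. S^3 with a left-invariant frame lifted to TM). *)

(* Defs.v *)
From HB Require Import structures.
From mathcomp Require Import all_boot all_order all_algebra.
From mathcomp Require Import all_classical all_reals all_analysis.
Set Implicit Arguments.
Unset Strict Implicit.
Unset Printing Implicit Defensive.
Import Order.TTheory GRing.Theory Num.Theory.
Import numFieldNormedType.Exports.
Local Open Scope classical_set_scope.
Local Open Scope ring_scope.

(** * Smooth manifolds *)

(* Meaningful for O open: C^k is expressed with iterated directional
   derivatives, which in finite dimension is the usual notion. *)
Fixpoint Ck_on (R : realType) (V W : normedModType R) (k : nat) (O : set V)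
    (f : V -> W) : Prop :=
  (forall p, O p -> {for p, continuous f}) /\
  match k with
  | 0 => True
  | k'.+1 => forall v : V,
      (forall p, O p -> derivable f p v) /\ Ck_on k' O ('D_v f)
  end.

Definition smooth_on (R : realType) (V W : normedModType R) (O : set V)
    (f : V -> W) : Prop :=
  forall k, Ck_on k O f.

Definition paracompact (X : topologicalType) : Prop :=
  forall U : set (set X),
    (forall A, U A -> open A) -> \bigcup_(A in U) A = [set: X] ->
  exists V : set (set X),
    [/\ forall B, V B -> open B,
        \bigcup_(B in V) B = [set: X],
        forall B, V B -> exists2 A, U A & B `<=` A
      & forall p : X, exists2 O : set X, nbhs p O &
          finite_set [set B | V B /\ (B `&` O !=set0)]].

(* [cinv c] is the inverse of the chart [cmap c : cdom c -> 'rV_n]; outside of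
   [cmap c @` cdom c] its values are irrelevant. *)
Record smooth_manifold (R : realType) (n : nat) := SmoothManifold {
  carrier :> topologicalType;
  chart : Type;
  cdom : chart -> set carrier;
  cmap : chart -> carrier -> 'rV[R]_n;
  cinv : chart -> 'rV[R]_n -> carrier;
  manifold_hausdorff : hausdorff_space carrier;
  manifold_paracompact : paracompact carrier;
  cdom_open : forall c, open (cdom c);
  cdom_cover : forall p, exists c, cdom c p;
  cimage_open : forall c, open (cmap c @` cdom c);
  cmapK : forall c p, cdom c p -> cinv c (cmap c p) = p;
  cmap_continuous : forall c, {within cdom c, continuous (cmap c)};
  cinv_continuous : forall c, {within cmap c @` cdom c, continuous (cinv c)};
  transition_smooth : forall c c' : chart,
    smooth_on [set x | (cmap c @` cdom c) x /\ cdom c' (cinv c x)]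
              (cmap c' \o cinv c)
}.

Section Bundle.
Variables (R : realType) (n : nat) (M : smooth_manifold R n).

Definition cimage (c : chart M) : set 'rV[R]_n := cmap c @` cdom c.

Definition transition (c c' : chart M) : 'rV[R]_n -> 'rV[R]_n :=
  cmap c' \o cinv c.

Definition overlap (c c' : chart M) : set 'rV[R]_n :=
  [set x | cimage c x /\ cdom c' (cinv c x)].

(* The chart c of M induces a chart of TM, with coordinates (x, y) ranging over
   [cimage c] times R^n; the transition maps are those of [tangent_map]. *)
Definition tdom (c : chart M) : set ('rV[R]_n * 'rV[R]_n) :=
  [set p | cimage c p.1].

Definition tangent_map (c c' : chart M) (p : 'rV[R]_n * 'rV[R]_n) :
    'rV[R]_n * 'rV[R]_n :=
  (transition c c' p.1, 'D_(p.2) (transition c c') p.1).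

(* [N c p a mu] is N^a_mu. The last field is, contracted with a vector v,
     N'^a_nu (d_mu x'^nu) = (d_b x'^a) N^b_mu - (d_mu d_b x'^a) y^b,
   i.e. it says that delta_mu = d_mu - N^a_mu d/dy^a transforms like d_mu on M. *)
Record nonlinear_connection := NonlinearConnection {
  ncoef :> chart M -> 'rV[R]_n * 'rV[R]_n -> 'M[R]_n;
  ncoef_smooth : forall c a mu, smooth_on (tdom c) (fun p => ncoef c p a mu);
  ncoef_transform : forall c c' (p : 'rV[R]_n * 'rV[R]_n) (v : 'rV[R]_n),
    overlap c c' p.1 ->
    'D_v (transition c c') p.1 *m (ncoef c' (tangent_map c c' p))^T =
    'D_(v *m (ncoef c p)^T) (transition c c') p.1
    - 'D_v ('D_(p.2) (transition c c')) p.1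
}.

End Bundle.

(* Horizontal (Greek) and vertical (Latin) indices. *)
Variant kind := hor | ver.

(* [lam c hor p i alpha] is lambda_i^alpha and [lam c ver p i a] is lambda_i^a,
   the components of lambda_i = lambda_i^alpha delta_alpha + lambda_i^a d/dy^a
   in the chart c; both transform with the Jacobian matrix of M. *)
Record EAPspace (R : realType) (n : nat) (M : smooth_manifold R n) :=
  EAPSpace {
  nlc : nonlinear_connection M;
  lam : chart M -> kind -> 'rV[R]_n * 'rV[R]_n -> 'M[R]_n;
  lam_smooth : forall c k i j, smooth_on (tdom c) (fun p => lam c k p i j);
  lam_free : forall c k p, tdom c p -> row_free (lam c k p);
  lam_transform : forall c c' k i p, overlap c c' p.1 ->
    row i (lam c' k (tangent_map c c' p)) =
    'D_(row i (lam c k p)) (transition c c') p.1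
}.

(* [aplam c x i alpha] is lambda_i^alpha(x). *)
Record APspace (R : realType) (n : nat) (M : smooth_manifold R n) := APSpace {
  aplam : chart M -> 'rV[R]_n -> 'M[R]_n;
  aplam_smooth : forall c i j, smooth_on (cimage c) (fun x => aplam c x i j);
  aplam_free : forall c x, cimage c x -> row_free (aplam c x);
  aplam_transform : forall c c' i x, overlap c c' x ->
    row i (aplam c' (transition c c' x)) =
    'D_(row i (aplam c x)) (transition c c') x
}.

(* The four connections attached to a parallelization. *)
Variant stdconn := cn_canonical | cn_dual | cn_symmetric | cn_natural.

(** * Geometry of TM in an induced chart *)

Section TMGeometry.
Variables (R : realType) (n : nat).
Local Notation I := 'I_n.
Local Notation scal := ('rV[R]_n * 'rV[R]_n -> R).
Variables (N : 'rV[R]_n * 'rV[R]_n -> 'M[R]_n)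
          (L : kind -> 'rV[R]_n * 'rV[R]_n -> 'M[R]_n).

Definition dx (mu : I) (f : scal) : scal :=
  'D_((delta_mx 0 mu, 0) : 'rV[R]_n * 'rV[R]_n) f.
Definition dy (a : I) (f : scal) : scal :=
  'D_((0, delta_mx 0 a) : 'rV[R]_n * 'rV[R]_n) f.

(* The adapted frame: delta_mu for [hor], d/dy^a for [ver]. *)
Definition fr (d : kind) (l : I) (f : scal) : scal :=
  match d with
  | hor => fun p => dx l f p - \sum_a N p a l * dy a f p
  | ver => dy l f
  end.

(* Vector fields on TM, by components in the natural frame (d_mu, d/dy^a). *)
Definition vfield := kind -> I -> scal.

Definition vact (X : vfield) (f : scal) : scal := fun p =>
  \sum_mu X hor mu p * dx mu f p + \sum_a X ver a p * dy a f p.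

Definition bracket (X Y : vfield) : vfield := fun k i p =>
  vact X (Y k i) p - vact Y (X k i) p.

(* Components in the adapted frame, and back. *)
Definition adapted (X : vfield) : vfield := fun k =>
  match k with
  | hor => X hor
  | ver => fun a p => X ver a p + \sum_mu N p a mu * X hor mu p
  end.
Definition of_adapted (X : vfield) : vfield := fun k =>
  match k with
  | hor => X hor
  | ver => fun a p => X ver a p - \sum_mu N p a mu * X hor mu p
  end.

Definition frame_field (d : kind) (l : I) : vfield :=
  of_adapted (fun k i _ =>
    match k, d with
    | hor, hor | ver, ver => (i == l)%:R
    | _, _ => 0
    end).

(* [D k d i j l] is the coefficient of the i-th adapted vector of kind k in the
   derivative, in the direction of the l-th adapted vector of kind d, of the
   j-th adapted vector of kind k:
     Gamma^alpha_{mu nu} = D hor hor alpha mu nu,  Gamma^a_{b nu} = D ver hor a b nu,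
     C^alpha_{mu c} = D hor ver alpha mu c,        C^a_{bc} = D ver ver a b c. *)
Definition dconn := kind -> kind -> I -> I -> I -> scal.

(* The linear connection on TM having these coefficients. *)
Definition nabla (D : dconn) (X Y : vfield) : vfield :=
  of_adapted (fun k i p =>
    vact X (adapted Y k i) p
    + \sum_j adapted Y k j p *
        (\sum_l adapted X hor l p * D k hor i j l p
         + \sum_l adapted X ver l p * D k ver i j l p)).

Definition curvature_op (D : dconn) (X Y Z : vfield) : vfield := fun k i p =>
  nabla D X (nabla D Y Z) k i p - nabla D Y (nabla D X Z) k i p
  - nabla D (bracket X Y) Z k i p.

(* R(e_l, e_m) e_j = [curvature D k d1 d2 i j l m] e_i, with e_l of kind d1, e_m
   of kind d2, and e_i, e_j of kind k. Thus
     R^alpha_{beta mu nu} = curvature D hor hor hor alpha beta mu nu,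
     P^alpha_{beta nu c}  = curvature D hor ver hor alpha beta c nu,
     S^alpha_{beta b c}   = curvature D hor ver ver alpha beta b c,
   and likewise, with k = ver, for R^a_{b mu nu}, P^a_{b nu c}, S^a_{bcd}. *)
Definition curvature (D : dconn) (k d1 d2 : kind) (i j l m : I) : scal :=
  adapted
    (curvature_op D (frame_field d1 l) (frame_field d2 m) (frame_field k j)) k i.

(* Covariant derivatives, in the direction of the l-th adapted vector of kind
   d (h-derivative for [hor], v-derivative for [ver]), of tensors with one upper
   index of kind k and zero, one or two lower indices. *)
Definition cov10 (D : dconn) (d k : kind) (T : I -> scal) (i l : I) : scal :=
  fun p => fr d l (T i) p + \sum_e T e p * D k d i e l p.

Definition cov11 (D : dconn) (d k k1 : kind) (T : I -> I -> scal)
    (i j l : I) : scal :=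
  fun p => fr d l (T i j) p + \sum_e T e j p * D k d i e l p
    - \sum_e T i e p * D k1 d e j l p.

Definition cov12 (D : dconn) (d k k1 k2 : kind) (T : I -> I -> I -> scal)
    (i j1 j2 l : I) : scal :=
  fun p => fr d l (T i j1 j2) p + \sum_e T e j1 j2 p * D k d i e l p
    - \sum_e T i e j2 p * D k1 d e j1 l p
    - \sum_e T i j1 e p * D k2 d e j2 l p.

Definition torsion_Lambda (D : dconn) (al mu nu : I) : scal := fun p =>
  D hor hor al mu nu p - D hor hor al nu mu p.
Definition torsion_R (a mu nu : I) : scal := fun p =>
  fr hor nu (fun q => N q a mu) p - fr hor mu (fun q => N q a nu) p.
Definition torsion_C (D : dconn) (al mu c : I) : scal := D hor ver al mu c.
Definition torsion_P (D : dconn) (a mu c : I) : scal := fun p =>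
  dy c (fun q => N q a mu) p - D ver hor a c mu p.
Definition torsion_T (D : dconn) (a b c : I) : scal := fun p =>
  D ver ver a b c p - D ver ver a c b p.

(* lambda_{i alpha} and lambda_{i a}: sum_j lambda_i^j lambda_{r j} = delta_ir. *)
Definition colam (k : kind) (i j : I) : scal := fun p => invmx (L k p) j i.

Definition metric (k : kind) (i j : I) : scal := fun p =>
  \sum_r colam k r i p * colam k r j p.
Definition metric_inv (k : kind) (i j : I) : scal := fun p =>
  invmx (\matrix_(u, v) metric k u v p) i j.

Definition canonical_conn : dconn := fun k d i j l p =>
  \sum_r L k p r i * fr d l (colam k r j) p.

Definition dual_conn : dconn := fun k d i j l =>
  match k, d with
  | hor, hor | ver, ver => canonical_conn k d i l j
  | _, _ => canonical_conn k d i j l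
  end.

Definition symmetric_conn : dconn := fun k d i j l =>
  match k, d with
  | hor, hor | ver, ver => fun p =>
      2^-1 * (canonical_conn k d i j l p + canonical_conn k d i l j p)
  | _, _ => canonical_conn k d i j l
  end.

Definition natural_metric_conn : dconn := fun k d =>
  match k, d with
  | hor, hor => fun al mu nu p =>
      2^-1 * \sum_e metric_inv hor al e p *
        (fr hor mu (metric hor e nu) p + fr hor nu (metric hor e mu) p
         - fr hor e (metric hor mu nu) p)
  | ver, hor => fun a b nu p =>
      dy b (fun q => N q a nu) p +
      2^-1 * \sum_c metric_inv ver a c p *
        (fr hor nu (metric ver b c) p
         - \sum_d metric ver d c p * dy b (fun q => N q d nu) p
         - \sum_d metric ver b d p * dy c (fun q => N q d nu) p)
  | hor, ver => fun al mu c p =>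
      2^-1 * \sum_e metric_inv hor al e p * dy c (metric hor mu e) p
  | ver, ver => fun a b c p =>
      2^-1 * \sum_d metric_inv ver a d p *
        (dy b (metric ver d c) p + dy c (metric ver d b) p
         - dy d (metric ver b c) p)
  end.

Definition std_dconn (s : stdconn) : dconn :=
  match s with
  | cn_canonical => canonical_conn
  | cn_dual => dual_conn
  | cn_symmetric => symmetric_conn
  | cn_natural => natural_metric_conn
  end.

Definition contortion (k d : kind) (i j l : I) : scal := fun p =>
  canonical_conn k d i j l p - natural_metric_conn k d i j l p.

(* [W i j l m] is W^i_{jlm}, with i, j of kind k, l of kind d1, m of kind d2:
   lambda is differentiated along l first, then along m, minus the converse. The
   case d1 = ver, d2 = hor is minus the transpose of d1 = hor, d2 = ver. *)
Definition is_Wtensor (U : set ('rV[R]_n * 'rV[R]_n)) (D : dconn)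
    (k d1 d2 : kind) (W : I -> I -> I -> I -> scal) : Prop :=
  forall (r i l m : I) p, U p ->
    let lr := fun (j : I) q => L k q r j in
    cov11 D d2 k d1 (cov10 D d1 k lr) i l m p
    - cov11 D d1 k d2 (cov10 D d2 k lr) i m l p
    = \sum_e lr e p * W i e l m p.

Lemma Wtensor_unique (U : set ('rV[R]_n * 'rV[R]_n)) (D : dconn)
    (k d1 d2 : kind) (W W' : I -> I -> I -> I -> scal) :
  (forall p, U p -> row_free (L k p)) ->
  is_Wtensor U D k d1 d2 W -> is_Wtensor U D k d1 d2 W' ->
  forall i j l m p, U p -> W i j l m p = W' i j l m p.
Proof.
move=> freeL HW HW' i j l m p Up.
pose w := \col_e (W i e l m p - W' i e l m p).
suff w0 : w = 0.
  by apply/eqP; rewrite -subr_eq0; move/colP: w0 => /(_ j); rewrite !mxE => ->.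
have Lu : L k p \in unitmx by rewrite -row_free_unit; exact: freeL.
rewrite -[w](mulKmx Lu); suff -> : L k p *m w = 0 by rewrite mulmx0.
apply/colP => r; rewrite !mxE.
under eq_bigr do rewrite mxE mulrBr.
by rewrite sumrB -(HW r i l m p Up) -(HW' r i l m p Up) subrr.
Qed.

End TMGeometry.

(** * Geometry of M in a chart *)

Section APGeometry.
Variables (R : realType) (n : nat).
Local Notation I := 'I_n.
Local Notation scal := ('rV[R]_n -> R).
Variable (L : 'rV[R]_n -> 'M[R]_n).

Definition bdx (mu : I) (f : scal) : scal := 'D_(delta_mx 0 mu) f.

Definition bvfield := I -> scal.

Definition bvact (X : bvfield) (f : scal) : scal := fun x =>
  \sum_mu X mu x * bdx mu f x.

Definition bbracket (X Y : bvfield) : bvfield := fun i x =>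
  bvact X (Y i) x - bvact Y (X i) x.

(* D_{d_nu} d_mu = (D alpha mu nu) d_alpha. *)
Definition bconn := I -> I -> I -> scal.

Definition bnabla (D : bconn) (X Y : bvfield) : bvfield := fun i x =>
  bvact X (Y i) x + \sum_j Y j x * \sum_l X l x * D i j l x.

Definition bcurvature_op (D : bconn) (X Y Z : bvfield) : bvfield := fun i x =>
  bnabla D X (bnabla D Y Z) i x - bnabla D Y (bnabla D X Z) i x
  - bnabla D (bbracket X Y) Z i x.

Definition bframe_field (l : I) : bvfield := fun i _ => (i == l)%:R.

(* R(d_mu, d_nu) d_beta = (bcurvature D alpha beta mu nu) d_alpha. *)
Definition bcurvature (D : bconn) (al be mu nu : I) : scal :=
  bcurvature_op D (bframe_field mu) (bframe_field nu) (bframe_field be) al.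

Definition bcov10 (D : bconn) (T : I -> scal) (i l : I) : scal := fun x =>
  bdx l (T i) x + \sum_e T e x * D i e l x.

Definition bcov11 (D : bconn) (T : I -> I -> scal) (i j l : I) : scal :=
  fun x => bdx l (T i j) x + \sum_e T e j x * D i e l x
    - \sum_e T i e x * D e j l x.

Definition bcolam (i j : I) : scal := fun x => invmx (L x) j i.

Definition ap_metric (i j : I) : scal := fun x =>
  \sum_r bcolam r i x * bcolam r j x.
Definition ap_metric_inv (i j : I) : scal := fun x =>
  invmx (\matrix_(u, v) ap_metric u v x) i j.

Definition ap_canonical : bconn := fun al mu nu x =>
  \sum_r L x r al * bdx nu (bcolam r mu) x.

Definition ap_levi_civita : bconn := fun al mu nu x =>
  2^-1 * \sum_e ap_metric_inv al e x *
    (bdx mu (ap_metric e nu) x + bdx nu (ap_metric e mu) x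
     - bdx e (ap_metric mu nu) x).

Definition ap_conn (s : stdconn) : bconn :=
  match s with
  | cn_canonical => ap_canonical
  | cn_dual => fun al mu nu => ap_canonical al nu mu
  | cn_symmetric => fun al mu nu x =>
      2^-1 * (ap_canonical al mu nu x + ap_canonical al nu mu x)
  | cn_natural => ap_levi_civita
  end.

Definition ap_torsion (al mu nu : I) : scal := fun x =>
  ap_canonical al mu nu x - ap_canonical al nu mu x.

Definition ap_contortion (al mu nu : I) : scal := fun x =>
  ap_canonical al mu nu x - ap_levi_civita al mu nu x.

Definition is_ap_Wtensor (U : set 'rV[R]_n) (D : bconn)
    (W : I -> I -> I -> I -> scal) : Prop :=
  forall (r al nu mu : I) x, U x ->
    let lr := fun (j : I) z => L z r j in
    bcov11 D (bcov10 D lr) al nu mu x - bcov11 D (bcov10 D lr) al mu nu x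
    = \sum_e lr e x * W al e nu mu x.

End APGeometry.

(** * The objects of an EAP-space, chart by chart *)

Section EAP.
Variables (R : realType) (n : nat) (M : smooth_manifold R n) (E : EAPspace M).
Local Notation I := 'I_n.

Definition eap_conn (c : chart M) (s : stdconn) : dconn R n :=
  std_dconn (nlc E c) (lam E c) s.

Definition CBcondition : Prop := forall c p, tdom c p ->
  [/\ forall a mu, nlc E c p a mu =
        \sum_b p.2 0 b * eap_conn c cn_canonical ver hor a b mu p,
      forall a c', \sum_b p.2 0 b * eap_conn c cn_canonical ver ver a b c' p = 0
    & forall al mu c', eap_conn c cn_canonical hor ver al mu c' p = 0].

Definition vanishes (c : chart M) (f : 'rV[R]_n * 'rV[R]_n -> R) : Prop :=
  forall p, tdom c p -> f p = 0.

Definition x_only (c : chart M) (f : 'rV[R]_n * 'rV[R]_n -> R) : Prop :=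
  forall x y y', cimage c x -> f (x, y) = f (x, y').

(* f is the lift to TM of the function g on M. *)
Definition lifts (c : chart M) (f : 'rV[R]_n * 'rV[R]_n -> R)
    (g : 'rV[R]_n -> R) : Prop :=
  forall x y, cimage c x -> f (x, y) = g x.

End EAP.

(* Main.v *)
Require Import Defs.
From HB Require Import structures.
From mathcomp Require Import all_boot all_order all_algebra.
From mathcomp Require Import all_classical all_reals all_analysis.
From mathcomp Require Import ring lra.
Set Implicit Arguments.
Unset Strict Implicit.
Unset Printing Implicit Defensive.
Import Order.TTheory GRing.Theory Num.Theory.
Import numFieldNormedType.Exports.
Local Open Scope classical_set_scope.
Local Open Scope ring_scope.

(* Write K_rb for the inverse matrix of the vertical components. The second
   CB-equation gives y^b d/dy^c K_rb = 0, so K_rc is the d/dy^c-derivative of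
   w_r = y^b K_rb, and hence d/dy^b K_rc = d/dy^c K_rb by symmetry of second
   derivatives. Thus K_rc is homogeneous of degree 0 in y; being smooth at y = 0,
   it depends on x only. The third equation gives the same for the horizontal
   components. From then on every object is the lift of one on M, and N is the
   linear connection y^b G^a_(b mu) of a parallelization, for which
   d/dy^b N^a_mu = G^a_(b mu).

   On M, the canonical connection is flat by symmetry of second derivatives, and
   the three curvature formulas are algebraic consequences: subtracting a tensor
   from a flat connection gives (a) and (c), and (b) is flatness with
   permuted indices. The Ricci identity then gives the W-tensors. *)

(** * Smooth functions on open sets *)

Section Calculus.
Context {R : realType} {V : normedModType R}.
Implicit Types (O : set V) (f g : V -> R) (p u v : V).

(** Smoothness is phrased with iterated directional derivatives, so linearity of ['D_v f] in [v] and
    symmetry of second derivatives have to be earned; both come from the mean value theorem and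
    continuity of the derivatives. The zero section matters twice: a function homogeneous of degree
    0 can be compared with its value at y = 0 because the frame is smooth there, and restriction to
    y = 0 supplies the objects on M. In each chart this yields two parallelizations. The horizontal
    one is the classical AP-space. The vertical one carries N, and its flatness does two jobs: it
    kills the curvatures on the vertical bundle, and it kills R^a_(mu nu), which is y^b times the
    curvature of that connection. *)

Lemma continuous_eq_on O f g p : open O -> O p ->
  (forall q, O q -> f q = g q) -> {for p, continuous f} -> {for p, continuous g}.
Proof.
move=> oO Op fg; have fgp : \near p, f p = g p.
  by apply: filterS (open_nbhs_nbhs (conj oO Op)) => q; exact: fg.
rewrite /prop_for /continuous_at -(fg _ Op); apply: cvg_trans.
exact: near_eq_cvg.
Qed.

Lemma derive_eq_on O f g p v : open O -> O p ->
  (forall q, O q -> f q = g q) -> 'D_v f p = 'D_v g p.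
Proof.
move=> oO Op fg; apply: near_eq_derive.
by apply: filterS (open_nbhs_nbhs (conj oO Op)) => q; exact: fg.
Qed.

Lemma derivable_eq_on O f g p v : open O -> O p ->
  (forall q, O q -> f q = g q) -> derivable f p v -> derivable g p v.
Proof.
move=> oO Op fg; apply: near_eq_derivable.
by apply: filterS (open_nbhs_nbhs (conj oO Op)) => q; exact: fg.
Qed.

Lemma Ck_on_eq k O f g : open O -> (forall q, O q -> f q = g q) ->
  Ck_on k O f -> Ck_on k O g.
Proof.
move=> oO; elim: k f g => [|k IH] f g fg /= [cf df]; split=> //.
- by move=> p Op; apply: continuous_eq_on fg (cf p Op).
- by move=> p Op; apply: continuous_eq_on fg (cf p Op).
- move=> v; have [df1 df2] := df v; split.
    by move=> p Op; apply: derivable_eq_on fg (df1 p Op).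
  by apply: IH df2 => q Oq; exact: derive_eq_on oO Oq fg.
Qed.

Lemma smooth_on_eq O f g : open O -> (forall q, O q -> f q = g q) ->
  smooth_on O f -> smooth_on O g.
Proof. by move=> oO fg sf k; exact: Ck_on_eq (sf k). Qed.

Lemma Ck_onW k O f : Ck_on k.+1 O f -> Ck_on k O f.
Proof.
elim: k f => [|k IH] f [cf df]; split=> // v.
by have [? ?] := df v; split=> //; exact: IH.
Qed.

Lemma smooth_on_derive O f v : smooth_on O f -> smooth_on O ('D_v f).
Proof. by move=> sf k; have [_ /(_ v) []] := sf k.+1. Qed.

Lemma smooth_on_continuous O f p :
  smooth_on O f -> O p -> {for p, continuous f}.
Proof. by move=> sf; have [cf _] := sf 0%N; exact: cf. Qed.

Lemma smooth_on_derivable O f p v : smooth_on O f -> O p -> derivable f p v.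
Proof. by move=> sf Op; have [_ /(_ v) [df _]] := sf 1%N; exact: df. Qed.

Lemma smooth_on_is_derive O f p v :
  smooth_on O f -> O p -> is_derive p v f ('D_v f p).
Proof. by move=> sf Op; exact/derivableP/(smooth_on_derivable sf Op). Qed.

Lemma smooth_on_cst O (r : R) : smooth_on O (fun=> r).
Proof.
move=> k; elim: k r => [|k IH] r; split=> //; try by move=> p _; exact: cst_continuous.
move=> v; split; first by move=> p _; exact: derivable_cst.
have -> : 'D_v (fun=> r) = (fun=> 0) :> (V -> R).
  by apply/funext => p; exact: derive_cst.
exact: IH.
Qed.

Lemma Ck_onD k O f g : open O -> Ck_on k O f -> Ck_on k O g ->
  Ck_on k O (fun p => f p + g p).
Proof.
move=> oO; elim: k f g => [|k IH] f g [cf df] [cg dg]; split=> //.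
- by move=> p Op; apply: continuousD; [exact: cf|exact: cg].
- by move=> p Op; apply: continuousD; [exact: cf|exact: cg].
move=> v; have [df1 df2] := df v; have [dg1 dg2] := dg v; split.
  by move=> p Op; apply: derivableD; [exact: df1|exact: dg1].
apply: Ck_on_eq (IH _ _ df2 dg2) => // q Oq.
by rewrite -[in RHS]/(f + g) deriveD//; [exact: df1|exact: dg1].
Qed.

Lemma Ck_onM k O f g : open O -> Ck_on k O f -> Ck_on k O g ->
  Ck_on k O (fun p => f p * g p).
Proof.
move=> oO; elim: k f g => [|k IH] f g Cf Cg.
  have [cf _] := Cf; have [cg _] := Cg.
  by split=> // p Op; apply: continuousM; [exact: cf|exact: cg].
have [cf df] := Cf; have [cg dg] := Cg; split.
  by move=> p Op; apply: continuousM; [exact: cf|exact: cg].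
move=> v; have [df1 df2] := df v; have [dg1 dg2] := dg v; split.
  by move=> p Op; apply: derivableM; [exact: df1|exact: dg1].
have C := Ck_onD oO (IH _ _ (Ck_onW Cf) dg2)
                             (IH _ _ (Ck_onW Cg) df2).
apply: Ck_on_eq C => // q Oq.
by rewrite -[in RHS]/(f * g) deriveM//; [exact: df1|exact: dg1].
Qed.

Lemma Ck_onV k O f : open O -> (forall q, O q -> f q != 0) -> Ck_on k O f ->
  Ck_on k O (fun p => (f p)^-1).
Proof.
move=> oO f0; elim: k => [|k IH] Cf.
  have [cf _] := Cf.
  by split=> // p Op; apply: continuousV; [exact: f0|exact: cf].
have [cf df] := Cf; split.
  by move=> p Op; apply: continuousV; [exact: f0|exact: cf].
move=> v; have [df1 df2] := df v; split.
  by move=> p Op; apply: derivableV; [exact: f0|exact: df1].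
have CV := IH (Ck_onW Cf).
(* The derivative of 1/f is (1/f)(1/f)(-1)f', so the induction hypothesis for 1/f itself closes the
   step. *)
have C := Ck_onM oO (Ck_onM oO CV CV)
  (Ck_onM oO (@smooth_on_cst O (-1) k) df2).
apply: Ck_on_eq C => // q Oq.
rewrite deriveV//; [|exact: f0|exact: df1].
by rewrite /GRing.scale /= -exprVn expr2; ring.
Qed.

Lemma smooth_onD O f g : open O -> smooth_on O f -> smooth_on O g ->
  smooth_on O (fun p => f p + g p).
Proof. by move=> oO sf sg k; exact: Ck_onD. Qed.

Lemma smooth_onM O f g : open O -> smooth_on O f -> smooth_on O g ->
  smooth_on O (fun p => f p * g p).
Proof. by move=> oO sf sg k; exact: Ck_onM. Qed.

Lemma smooth_onV O f : open O -> (forall q, O q -> f q != 0) ->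
  smooth_on O f -> smooth_on O (fun p => (f p)^-1).
Proof. by move=> oO f0 sf k; exact: Ck_onV. Qed.

Lemma smooth_on_sum O (J : Type) (r : seq J) (P : pred J) (F : J -> V -> R) :
  open O -> (forall j, smooth_on O (F j)) ->
  smooth_on O (fun p => \sum_(j <- r | P j) F j p).
Proof.
move=> oO sF; elim: r => [|j r IH].
  under [X in smooth_on _ X]eq_fun do rewrite big_nil.
  exact: smooth_on_cst.
under [X in smooth_on _ X]eq_fun do rewrite big_cons.
by case: (P j) => //; exact: smooth_onD.
Qed.

Lemma smooth_on_prod O (J : Type) (r : seq J) (P : pred J) (F : J -> V -> R) :
  open O -> (forall j, smooth_on O (F j)) ->
  smooth_on O (fun p => \prod_(j <- r | P j) F j p).
Proof.
move=> oO sF; elim: r => [|j r IH].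
  under [X in smooth_on _ X]eq_fun do rewrite big_nil.
  exact: smooth_on_cst.
under [X in smooth_on _ X]eq_fun do rewrite big_cons.
by case: (P j) => //; exact: smooth_onM.
Qed.

Lemma smooth_on_det O m (A : V -> 'M[R]_m) : open O ->
  (forall i j, smooth_on O (fun p => A p i j)) ->
  smooth_on O (fun p => \det (A p)).
Proof.
move=> oO sA; rewrite /determinant; apply: smooth_on_sum => // s.
by apply: smooth_onM => //; [exact: smooth_on_cst|exact: smooth_on_prod].
Qed.

(** By Cramer's rule an entry of the inverse is a cofactor divided by a determinant that does not
    vanish on [O]. *)
Lemma smooth_on_invmx O m (A : V -> 'M[R]_m) i j : open O ->
  (forall p, O p -> row_free (A p)) ->
  (forall i j, smooth_on O (fun p => A p i j)) ->
  smooth_on O (fun p => invmx (A p) i j).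
Proof.
move=> oO fA sA.
have uA p : O p -> A p \in unitmx by move=> /fA; rewrite row_free_unit.
have s : smooth_on O (fun p => (\det (A p))^-1 * cofactor (A p) j i).
  apply: smooth_onM => //.
    apply: smooth_onV => //; last exact: smooth_on_det.
    by move=> q /uA; rewrite unitmxE unitfE.
  rewrite /cofactor; apply: smooth_onM => //; first exact: smooth_on_cst.
  apply: smooth_on_det => // a b; under eq_fun do rewrite !mxE.
  exact: sA.
by apply: smooth_on_eq s => // q Oq; rewrite /invmx uA// !mxE.
Qed.

Lemma is_derive_sum_fun m (h : 'I_m -> V -> R) (dh : 'I_m -> R) p v :
  (forall i, is_derive p v (h i) (dh i)) ->
  is_derive p v (fun q => \sum_i h i q) (\sum_i dh i).
Proof.
move=> dhP; rewrite (_ : (fun q => _) = \sum_i h i); first exact: is_derive_sum.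
by apply/funext => q; rewrite fct_sumE.
Qed.

Lemma is_deriveM_fun f g (df dg : R) p v :
  is_derive p v f df -> is_derive p v g dg ->
  is_derive p v (fun q => f q * g q) (df * g p + f p * dg).
Proof.
move=> hf hg; rewrite (_ : _ + _ = f p *: dg + g p *: df).
  exact: is_deriveM.
by rewrite [RHS]addrC [g p *: _]mulrC.
Qed.

(** * Mean value theorem along lines, and its consequences for directional derivatives *)

Lemma is_derive_line f p v (d t : R) :
  is_derive (t *: v + p) v f d ->
  is_derive t 1 (fun s : R => f (s *: v + p)) d.
Proof.
have E : (fun h : R => h^-1 *: (((fun s : R => f (s *: v + p)) \o shift t) (h *: 1)
            - f (t *: v + p))) =
    (fun h : R => h^-1 *: ((f \o shift (t *: v + p)) (h *: v) - f (t *: v + p))).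
  by apply/funext => h /=; rewrite scalerDl addrA [h%:A]mulr1.
by case=> df dE; apply: DeriveDef; rewrite /derivable /derive E.
Qed.

Lemma line_MVT f p v (s : R) : 0 < s ->
  (forall t, 0 <= t <= s -> derivable f (t *: v + p) v) ->
  exists2 t, 0 <= t <= s & f (s *: v + p) - f p = s * 'D_v f (t *: v + p).
Proof.
move=> s0 df.
have D t : 0 <= t <= s ->
    is_derive t 1 (fun s : R => f (s *: v + p)) ('D_v f (t *: v + p)).
  by move=> ts; apply: is_derive_line; exact/derivableP/df.
have [| |t] := @MVT R (fun s : R => f (s *: v + p))
    (fun t => 'D_v f (t *: v + p)) 0 s s0.
- by move=> t; rewrite in_itv /= => /andP[t0 ts]; apply: D; rewrite !ltW.
- apply: derivable_within_continuous => t; rewrite in_itv /= => ts.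
  by case: (D t ts).
rewrite in_itv /= => /andP[t0 ts] E; exists t; first by rewrite !ltW.
by move: E; rewrite subr0 scale0r add0r mulrC.
Qed.

(** Supplies a step [s] so small that every point produced by the mean value theorem on the
    parallelogram spanned by [s *: u] and [s *: v] stays in the given neighbourhood. *)
Lemma near_small_square p u v (P : V -> Prop) : (\forall q \near p, P q) ->
  exists2 s : R, 0 < s & forall a b, 0 <= a <= s -> 0 <= b <= s ->
    P (a *: u + (b *: v + p)).
Proof.
move=> /nbhs_ballP[r /= r0 rP].
have d0 : 0 < `|u| + `|v| + 1 by rewrite ltr_wpDl// addr_ge0.
(* The summand 1 keeps the denominator positive when [u] and [v] are both 0, and makes the bound on
   the distance strict. *)
exists (r / (`|u| + `|v| + 1)); first exact: divr_gt0.
move=> a b /andP[a0 ar] /andP[b0 br]; apply: rP.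
rewrite -ball_normE /= addrA opprD addrCA subrr addr0 normrN.
apply: le_lt_trans (ler_normD _ _) _; rewrite !normrZ !ger0_norm//.
apply: (@le_lt_trans _ _ (r / (`|u| + `|v| + 1) * (`|u| + `|v|))).
  by rewrite mulrDr lerD// ler_wpM2r.
by rewrite -mulrA gtr_pMr// mulrC ltr_pdivrMr// mul1r ltrDl.
Qed.

(** Two uses of the mean value theorem: along [u] for the increment [g q = f (s *: v + q) - f q],
    then along [v] for ['D_u f]. *)
Lemma second_difference f p u v (s : R) : 0 < s ->
  (forall a b, 0 <= a <= s -> 0 <= b <= s ->
     derivable f (a *: u + (b *: v + p)) u /\
     derivable ('D_u f) (a *: u + (b *: v + p)) v) ->
  exists a b, [/\ 0 <= a <= s, 0 <= b <= s &
    f (s *: u + (s *: v + p)) - f (s *: u + p) - (f (s *: v + p) - f p)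
    = s * (s * 'D_v ('D_u f) (a *: u + (b *: v + p)))].
Proof.
move=> s0 df; pose g q := f (s *: v + q) - f q.
have i0 : 0 <= (0 : R) <= s by rewrite lexx ltW.
have iS : 0 <= s <= s by rewrite lexx ltW.
have D a : 0 <= a <= s -> is_derive (a *: u + p) u g
    ('D_u f (a *: u + (s *: v + p)) - 'D_u f (a *: u + p)).
  move=> ai; have [d1 _] := df a s ai iS; have [d0 _] := df a 0 ai i0.
  rewrite scale0r add0r in d0; apply: is_deriveB; last exact/derivableP.
  move: d1; rewrite addrCA => /derivableP[d1 dE].
  have E : (fun h : R => h^-1 *:
      (((fun q => f (s *: v + q)) \o shift (a *: u + p)) (h *: u)
            - f (s *: v + (a *: u + p)))) =
    (fun h : R => h^-1 *: ((f \o shift (s *: v + (a *: u + p))) (h *: u)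
       - f (s *: v + (a *: u + p)))).
    by apply/funext => h /=; rewrite addrCA.
  by apply: DeriveDef; rewrite /derivable /derive E.
have [|a ai] := @line_MVT g p u s s0.
  by move=> t /D[].
have := D a ai => /@derive_val ->.
rewrite {1 2}/g [s *: v + (s *: u + p)]addrCA => ->.
have [|b bi] := @line_MVT ('D_u f) (a *: u + p) v s s0.
  by move=> t ti; rewrite addrCA; case: (df a t ai ti).
rewrite (addrCA (s *: v)) => ->; exists a, b; split; [exact: ai|exact: bi|].
by rewrite (addrCA (a *: u)).
Qed.

Lemma eq_from_close (x y : R) : (forall e, 0 < e -> `|x - y| <= e) -> x = y.
Proof.
move=> h; apply/eqP; rewrite -subr_eq0 -normr_le0.
by apply/ler_addgt0Pr => e e0; rewrite add0r h.
Qed.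

Lemma dist_le_split2 (x y z z' e : R) :
  `|y - z| < e / 2 -> `|x - z'| < e / 2 -> z = z' -> `|x - y| <= e.
Proof.
rewrite !ltr_norml => /andP[? ?] /andP[? ?] ?.
by rewrite ler_norml; apply/andP; split; lra.
Qed.

Lemma dist_le_split3 (x y z x' y' z' e : R) :
  `|x - x'| <= e / 3 -> `|y - y'| <= e / 3 -> `|z - z'| <= e / 3 ->
  x' = y' + z' -> `|x - (y + z)| <= e.
Proof.
rewrite !ler_norml => /andP[? ?] /andP[? ?] /andP[? ?] ?.
by apply/andP; split; lra.
Qed.

(** The second difference on the parallelogram is symmetric in [u] and [v], so the two mixed
    derivatives agree at two points near [p]; their continuity brings both points to [p]. *)
Lemma derive_comm O f p u v : open O -> smooth_on O f -> O p ->
  'D_u ('D_v f) p = 'D_v ('D_u f) p.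
Proof.
move=> oO sf Op.
have cvg w w' (e : R) : 0 < e ->
    \forall q \near p, O q /\ `|'D_w ('D_w' f) p - 'D_w ('D_w' f) q| < e.
  move=> e0; apply: filterI; first exact: (open_nbhs_nbhs (conj oO Op)).
  have := smooth_on_continuous
    (smooth_on_derive w (smooth_on_derive w' sf)) Op.
  by move=> /cvgrPdist_lt /(_ e e0).
apply: eq_from_close => e e0; have e20 : 0 < e / 2 by rewrite divr_gt0.
have [s s0 sP] := @near_small_square p u v _ (filterI (cvg u v _ e20) (cvg v u _ e20)).
have [a b ai bi|a [b [ai bi E1]]] := @second_difference f p u v s s0.
  have [[Oq _] _] := sP a b ai bi.
  by split; apply: (smooth_on_derivable (O := O)) => //; exact: smooth_on_derive.
have [b' a' bi' ai'|b' [a' [bi' ai' E2]]] := @second_difference f p v u s s0.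
  have [[Oq _] _] := sP a' b' ai' bi'; rewrite addrCA.
  by split; apply: (smooth_on_derivable (O := O)) => //; exact: smooth_on_derive.
have E : 'D_v ('D_u f) (a *: u + (b *: v + p)) =
         'D_u ('D_v f) (a' *: u + (b' *: v + p)).
  rewrite (addrCA (s *: v)) (addrCA (b' *: v)) in E2.
  have key (X Y A B : R) : A = s * (s * X) -> B = s * (s * Y) -> A = B -> X = Y.
    by move=> -> -> /(mulfI (lt0r_neq0 s0)) /(mulfI (lt0r_neq0 s0)).
  by apply: key E1 E2 _; ring.
have [_ [_ h1]] := sP a b ai bi; have [[_ h2] _] := sP a' b' ai' bi'.
exact: dist_le_split2 h1 h2 E.
Qed.

(** Passing from [p] to [s *: (u + v) + p] through [s *: v + p] splits one increment of [f] into
    two. The mean value theorem turns each of the three increments into a derivative near [p], and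
    continuity concludes. *)
Lemma derive_dirD O f p u v : open O -> smooth_on O f -> O p ->
  'D_(u + v) f p = 'D_u f p + 'D_v f p.
Proof.
move=> oO sf Op.
have cvg w (e : R) : 0 < e ->
    \forall q \near p, O q /\ `|'D_w f p - 'D_w f q| <= e.
  move=> e0; apply: filterI; first exact: (open_nbhs_nbhs (conj oO Op)).
  have := smooth_on_continuous (smooth_on_derive w sf) Op.
  by move=> /cvgrPdist_le /(_ e e0).
apply: eq_from_close => e e0; have e30 : 0 < e / 3 by rewrite divr_gt0.
have [s s0 sP] := @near_small_square p u v _
  (filterI (cvg (u + v) _ e30) (filterI (cvg u _ e30) (cvg v _ e30))).
have i0 : 0 <= (0 : R) <= s by rewrite lexx ltW.
have iS : 0 <= s <= s by rewrite lexx ltW.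
have [t ti|a ai E1] := @line_MVT f p (u + v) s s0.
  have [[Oq _] _] := sP t t ti ti; rewrite scalerDr -addrA.
  exact: (smooth_on_derivable (O := O)).
have [t ti|b bi E2] := @line_MVT f (s *: v + p) u s s0.
  by have [[Oq _] _] := sP t s ti iS; exact: (smooth_on_derivable (O := O)).
have [t ti|c ci E3] := @line_MVT f p v s s0.
  have [[Oq _] _] := sP 0 t i0 ti; rewrite scale0r add0r in Oq.
  exact: (smooth_on_derivable (O := O)).
have E : 'D_(u + v) f (a *: (u + v) + p) =
         'D_u f (b *: u + (s *: v + p)) + 'D_v f (c *: v + p).
  apply: (mulfI (lt0r_neq0 s0)); rewrite mulrDr -E1 -E2 -E3.
  by rewrite scalerDr -addrA subrKA.
have [[_ h1] _] := sP a a ai ai; have [_ [[_ h2] _]] := sP b s bi iS.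
have [_ [_ [_ h3]]] := sP 0 c i0 ci.
rewrite scale0r add0r in h3.
rewrite addrA -scalerDr in h1.
exact: dist_le_split3 h1 h2 h3 E.
Qed.

(** Chain rule for the rescaling of the line through [p] by the factor [c]. *)
Lemma derive_dirZ O f p v (c : R) : smooth_on O f -> O p ->
  'D_(c *: v) f p = c * 'D_v f p.
Proof.
move=> sf Op; have dv : derivable f p v := smooth_on_derivable sf Op.
have [->|c0] := eqVneq c 0; first by rewrite scale0r derive0 mul0r.
pose g (s : R) := f (s *: v + p).
have dg : is_derive (0 : R) 1 g ('D_v f p).
  by apply: is_derive_line; rewrite scale0r add0r; exact: derivableP.
have dgc : is_derive (0 : R) 1 (g \o *%R^~ c) ('D_(c *: v) f p).
  rewrite (_ : g \o _ = fun s : R => f (s *: (c *: v) + p)); last first.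
    by apply/funext => s; rewrite /g /= scalerA.
  apply: is_derive_line; rewrite scale0r add0r; apply: derivableP.
  exact: smooth_on_derivable sf Op.
have dc : is_derive (0 : R) 1 ( *%R^~ c) c.
  have := is_deriveM (is_derive_id (0 : R) 1) (is_derive_cst c (0 : R) 1).
  by rewrite scaler0 add0r [c *: _]mulr1.
case: dg dgc dc => dg E1 [_ E2] [dc E3].
rewrite -(mul0r c) in dg; have := derive1_comp dc dg.
by rewrite !derive1E mul0r E1 E2 E3 mulrC.
Qed.

Lemma derive_dir_sum O f p m (c : 'I_m -> R) (e : 'I_m -> V) : open O ->
  smooth_on O f -> O p ->
  'D_(\sum_i c i *: e i) f p = \sum_i c i * 'D_(e i) f p.
Proof.
move=> oO sf Op; elim/big_ind2: _ => [|v x w y <- <-|i _].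
- exact: derive0.
- exact: derive_dirD sf Op.
- exact: derive_dirZ sf Op.
Qed.

Lemma derive_sumM O m (f g : 'I_m -> V -> R) p v :
  (forall i, smooth_on O (f i)) -> (forall i, smooth_on O (g i)) -> O p ->
  'D_v (fun q => \sum_i f i q * g i q) p =
  \sum_i ('D_v (f i) p * g i p + f i p * 'D_v (g i) p).
Proof.
move=> sf sg Op; suff [] : is_derive p v (fun q => \sum_i f i q * g i q)
  (\sum_i ('D_v (f i) p * g i p + f i p * 'D_v (g i) p)) by [].
apply: is_derive_sum_fun => i; apply: is_deriveM_fun.
  exact: smooth_on_is_derive (sf i) Op.
exact: smooth_on_is_derive (sg i) Op.
Qed.

Lemma derive_addE O f g p v : smooth_on O f -> smooth_on O g -> O p ->
  'D_v (fun q => f q + g q) p = 'D_v f p + 'D_v g p.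
Proof.
move=> sf sg Op; rewrite (_ : (fun q => f q + g q) = f + g) // deriveD//.
  exact: smooth_on_derivable sf Op.
exact: smooth_on_derivable sg Op.
Qed.

Lemma derive_subE O f g p v : smooth_on O f -> smooth_on O g -> O p ->
  'D_v (fun q => f q - g q) p = 'D_v f p - 'D_v g p.
Proof.
move=> sf sg Op; rewrite (_ : (fun q => f q - g q) = f - g) // deriveB//.
  exact: smooth_on_derivable sf Op.
exact: smooth_on_derivable sg Op.
Qed.

Lemma derive_scaleE O f (r : R) p v : smooth_on O f -> O p ->
  'D_v (fun q => r * f q) p = r * 'D_v f p.
Proof.
move=> sf Op; rewrite (_ : (fun q => r * f q) = r *: f) // deriveZ//.
exact: smooth_on_derivable sf Op.
Qed.

(* [t = 0] is excluded because homogeneity only controls [t * 'D_v f]. *)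
Lemma constant_on_ray O f p v : smooth_on O f ->
  (forall t : R, 0 <= t <= 1 -> O (t *: v + p)) ->
  (forall t : R, 0 < t <= 1 -> 'D_v f (t *: v + p) = 0) ->
  f (v + p) = f p.
Proof.
move=> sf tO df0.
have D (t : R) : 0 <= t <= 1 ->
    is_derive t 1 (fun s : R => f (s *: v + p)) ('D_v f (t *: v + p)).
  by move=> ti; apply: is_derive_line; exact: smooth_on_is_derive sf (tO _ ti).
have [| |t] := @MVT R (fun s : R => f (s *: v + p))
    (fun t => 'D_v f (t *: v + p)) 0 1 ltr01.
- by move=> t; rewrite in_itv /= => /andP[t0 ts]; apply: D; rewrite !ltW.
- apply: derivable_within_continuous => t; rewrite in_itv /= => ts.
  by case: (D t ts).
rewrite in_itv /= => /andP[t0 t1]; rewrite df0 ?t0 ?ltW// mul0r => /eqP.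
by rewrite scale1r scale0r add0r subr_eq0 => /eqP.
Qed.

End Calculus.

(** * Parallelizations of M *)

Section ConnectionAlgebra.
Context {R : realType} {n : nat}.
Local Notation I := 'I_n.
Implicit Types (G H T : I -> I -> I -> R) (dG dH dT : I -> I -> I -> I -> R).

(* [dG i j l m] stands for the derivative of [G i j l] along [m]; likewise
   for [dT]. *)
Definition curv_coef G dG (al be mu nu : I) : R :=
  dG al be nu mu - dG al be mu nu
  + (\sum_e G e be nu * G al e mu - \sum_e G e be mu * G al e nu).

Definition cov_coef G T dT (i j1 j2 l : I) : R :=
  dT i j1 j2 l + \sum_e T e j1 j2 * G i e l
    - \sum_e T i e j2 * G e j1 l - \sum_e T i j1 e * G e j2 l.

Lemma sum_delta_l (f : I -> R) j : \sum_i (i == j)%:R * f i = f j.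
Proof.
rewrite (bigD1 j)//= eqxx mul1r big1 ?addr0// => i /negPf ->.
by rewrite mul0r.
Qed.

Lemma sum_delta_r (f : I -> R) j : \sum_i f i * (i == j)%:R = f j.
Proof. by rewrite -[RHS](sum_delta_l f); apply: eq_bigr => i _; rewrite mulrC. Qed.

Lemma sum_mulBl (f g h : I -> R) :
  \sum_e (f e - g e) * h e = \sum_e f e * h e - \sum_e g e * h e.
Proof. by rewrite -sumrB; apply: eq_bigr => e _; rewrite mulrBl. Qed.

Lemma sum_mulBr (f g h : I -> R) :
  \sum_e h e * (f e - g e) = \sum_e h e * f e - \sum_e h e * g e.
Proof. by rewrite -sumrB; apply: eq_bigr => e _; rewrite mulrBr. Qed.

Lemma sum_mulDl (f g h : I -> R) :
  \sum_e (f e + g e) * h e = \sum_e f e * h e + \sum_e g e * h e.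
Proof. by rewrite -big_split; apply: eq_bigr => e _; rewrite mulrDl. Qed.

Lemma sum_mulDr (f g h : I -> R) :
  \sum_e h e * (f e + g e) = \sum_e h e * f e + \sum_e h e * g e.
Proof. by rewrite -big_split; apply: eq_bigr => e _; rewrite mulrDr. Qed.

Lemma sum_mulZl (c : R) (f h : I -> R) :
  \sum_e c * f e * h e = c * \sum_e f e * h e.
Proof. by rewrite mulr_sumr; apply: eq_bigr => e _; rewrite mulrA. Qed.

Lemma sum_mulZr (c : R) (f h : I -> R) :
  \sum_e h e * (c * f e) = c * \sum_e h e * f e.
Proof. by rewrite mulr_sumr; apply: eq_bigr => e _; rewrite mulrCA. Qed.

Lemma sum_mulC (f g : I -> R) : \sum_e f e * g e = \sum_e g e * f e.
Proof. by apply: eq_bigr => e _; rewrite mulrC. Qed.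

(** Bookkeeping for the Ricci identity: [l1] and [l2] are first derivatives of the vector [l], [d]
    is its common second derivative, and [c] its covariant derivative. The terms with [l1] and [l2]
    occur in both orders of differentiation and cancel. *)
Lemma ricci_sums (d A B X Y : R) (l c l1 l2 D1 D2 E1 E2 S1 S2 T1 T2 : I -> R) :
  A = d + (\sum_e l1 e * D2 e + \sum_e l e * E2 e) ->
  B = d + (\sum_e l2 e * D1 e + \sum_e l e * E1 e) ->
  X = \sum_e l2 e * D1 e + \sum_e l e * S2 e ->
  Y = \sum_e l1 e * D2 e + \sum_e l e * S1 e ->
  A + X - \sum_e c e * T2 e - (B + Y - \sum_e c e * T1 e)
  = \sum_e l e * (E2 e - E1 e + (S2 e - S1 e)) - \sum_e c e * (T2 e - T1 e).
Proof. by move=> -> -> -> ->; rewrite sum_mulDr !sum_mulBr; ring. Qed.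

(** Expansion of the curvature of H = G - T. The last sum compensates for the covariant derivatives:
    the contraction of G with the direction index of T does not cancel under antisymmetrization and
    leaves the torsion of G. *)
Lemma curv_coef_contortion G dG H dH al be mu nu :
  curv_coef G dG al be mu nu = 0 ->
  let T := fun i j l => G i j l - H i j l in
  let dT := fun i j l m => dG i j l m - dH i j l m in
  curv_coef H dH al be mu nu =
    (cov_coef G T dT al be mu nu - cov_coef G T dT al be nu mu)
    + \sum_e (T e be nu * T al e mu - T e be mu * T al e nu)
    + \sum_e T al be e * (G e mu nu - G e nu mu).
Proof.
rewrite /curv_coef /cov_coef /= => flat.
rewrite sumrB !(sum_mulBl, sum_mulBr).
rewrite (sum_mulC (fun e => G al e mu)) (sum_mulC (fun e => G al e nu)).
rewrite (sum_mulC (fun e => H al e mu)) (sum_mulC (fun e => H al e nu)).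
lra.
Qed.

(** Flatness at (nu; mu, be) and at (mu; nu, be) trades the derivatives of the torsion along be for
    derivatives of G along mu and nu, which are those in the curvature of the transposed
    connection. *)
Lemma curv_coef_dual G dG al be mu nu :
  (forall al be mu nu, curv_coef G dG al be mu nu = 0) ->
  let L := fun i j l => G i j l - G i l j in
  let dL := fun i j l m => dG i j l m - dG i l j m in
  curv_coef (fun i j l => G i l j) (fun i j l m => dG i l j m) al be mu nu =
  cov_coef G L dL al nu mu be.
Proof.
move=> flat /=; have := flat al nu mu be; have := flat al mu nu be.
rewrite /curv_coef /cov_coef !(sum_mulBl, sum_mulBr).
rewrite (sum_mulC (fun e => G al e mu)) (sum_mulC (fun e => G al e nu)).
rewrite (sum_mulC (fun e => G al mu e)) (sum_mulC (fun e => G al nu e)).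
move=> h1 h2; lra.
Qed.

(** The symmetric part of G is G - L/2, so this is the expansion for the contortion L/2: the
    quadratic terms account for 1/4, the others for 1/2, and antisymmetry of L gives the index order
    of the quadratic sum. *)
Lemma curv_coef_symmetric G dG al be mu nu :
  curv_coef G dG al be mu nu = 0 ->
  let L := fun i j l => G i j l - G i l j in
  let dL := fun i j l m => dG i j l m - dG i l j m in
  curv_coef (fun i j l => 2^-1 * (G i j l + G i l j))
            (fun i j l m => 2^-1 * (dG i j l m + dG i l j m)) al be mu nu =
  2^-1 * (cov_coef G L dL al be mu nu - cov_coef G L dL al be nu mu)
  + 4^-1 * \sum_e (L e be mu * L al nu e - L e be nu * L al mu e)
  + 2^-1 * \sum_e L e mu nu * L al be e.
Proof.
move=> flat /=; move: flat; rewrite /curv_coef /cov_coef => flat.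
rewrite sumrB !(sum_mulZl, sum_mulZr) !(sum_mulBl, sum_mulBr, sum_mulDl, sum_mulDr).
rewrite !(sum_mulC (fun e => G al e mu)) !(sum_mulC (fun e => G al e nu)).
rewrite !(sum_mulC (fun e => G al mu e)) !(sum_mulC (fun e => G al nu e)).
rewrite !(sum_mulC (fun e => G al be e)) !(sum_mulC (fun e => G al e be)).
lra.
Qed.

End ConnectionAlgebra.

(** * Inverse matrices and the inverse metric *)

Section InverseMatrix.
Context {F : fieldType} {n : nat}.
Implicit Types A : 'M[F]_n.

Lemma sum_invmxl A i j : row_free A ->
  \sum_r A r i * invmx A j r = (i == j)%:R.
Proof.
rewrite row_free_unit => uA; have /matrixP/(_ j i) := mulVmx uA.
rewrite !mxE eq_sym => <-; apply: eq_bigr => r _; exact: mulrC.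
Qed.

Lemma sum_invmxr A r s : row_free A ->
  \sum_i A r i * invmx A i s = (r == s)%:R.
Proof.
by rewrite row_free_unit => uA; have /matrixP/(_ r s) := mulmxV uA; rewrite !mxE.
Qed.

Lemma sum_row_inj A (X : 'I_n -> F) : row_free A ->
  (forall r, \sum_i A r i * X i = 0) -> forall i, X i = 0.
Proof.
rewrite row_free_unit => uA X0 i.
suff /colP/(_ i) : \col_i X i = 0 by rewrite !mxE.
rewrite -[LHS](mulKmx uA) (_ : A *m _ = 0) ?mulmx0//.
apply/colP => r; rewrite !mxE -[RHS](X0 r).
by apply: eq_bigr => e _; rewrite mxE.
Qed.

(** This is g^(ij) = lambda_r^i lambda_r^j, which reduces smoothness of the inverse metric to that
    of a sum of products. *)
Lemma invmx_gram A : row_free A ->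
  invmx (\matrix_(u, v) \sum_r invmx A u r * invmx A v r) = A^T *m A.
Proof.
move=> fA; have uA : A \in unitmx by rewrite -row_free_unit.
set X := \matrix_(u, v) _.
have XE : X *m (A^T *m A) = 1%:M.
  have -> : X = invmx A *m (invmx A)^T.
    by apply/matrixP => u v; rewrite !mxE; apply: eq_bigr => r _; rewrite mxE.
  by rewrite -mulmxA [_^T *m (_ *m _)]mulmxA -trmx_mul mulmxV// trmx1 mul1mx mulVmx.
have [uX _] := mulmx1_unit XE.
by rewrite -[LHS]mulmx1 -XE mulKmx.
Qed.

End InverseMatrix.

(** * The four connections of a parallelization of an open set *)

Section Base.
Context {R : realType} {n : nat}.
Local Notation I := 'I_n.
Implicit Types (D : bconn R n) (x : 'rV[R]_n).

Lemma bcurvatureE D al be mu nu x :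
  bcurvature D al be mu nu x =
  curv_coef (fun i j l => D i j l x)
            (fun i j l m => bdx m (D i j l) x) al be mu nu.
Proof.
have act (X : bvfield R n) (r : R) : bvact X (fun=> r) = fun=> 0.
  by apply/funext => y; rewrite /bvact big1// => i _; rewrite /bdx derive_cst mulr0.
have frameact l f : bvact (@bframe_field R n l) f = bdx l f.
  by apply/funext => y; rewrite /bvact sum_delta_l.
have nab l j : bnabla D (@bframe_field R n l) (@bframe_field R n j) =
    fun i => D i j l.
  apply/funext => i; apply/funext => y; rewrite /bnabla act add0r sum_delta_l.
  by rewrite sum_delta_l.
have brk l m : bbracket (@bframe_field R n l) (@bframe_field R n m) = fun _ _ => 0.
  by apply/funext => i; apply/funext => y; rewrite /bbracket !act subrr.
have nab0 Z : bnabla D (fun _ _ => 0) Z = fun _ _ => 0.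
  apply/funext => i; apply/funext => y; rewrite /bnabla /bvact.
  rewrite !big1 ?addr0// => j _; rewrite ?mul0r// big1 ?mulr0// => k _.
  by rewrite mul0r.
rewrite /bcurvature /bcurvature_op brk nab0 !nab /bnabla !frameact.
rewrite subr0 /curv_coef.
under eq_bigr do rewrite sum_delta_l.
under [X in _ - (_ + X)]eq_bigr do rewrite sum_delta_l.
ring.
Qed.

Context (U : set 'rV[R]_n) (L : 'rV[R]_n -> 'M[R]_n).
Context (oU : open U) (sL : forall i j, smooth_on U (fun z => L z i j))
        (fL : forall z, U z -> row_free (L z)).
Local Notation K := (bcolam L).
Local Notation G := (ap_canonical L).

Lemma bcolam_inj x (X : I -> R) : U x ->
  (forall r, \sum_i K r i x * X i = 0) -> forall a, X a = 0.
Proof.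
move=> Ux X0; apply: (@sum_row_inj _ _ (invmx (L x))^T) => [|r].
  by rewrite row_free_unit unitmx_tr unitmx_inv -row_free_unit; exact: fL.
by rewrite -[RHS](X0 r); apply: eq_bigr => i _; rewrite mxE.
Qed.

Lemma smooth_on_bcolam r i : smooth_on U (K r i).
Proof. exact: smooth_on_invmx. Qed.

Lemma smooth_on_bdx mu f : smooth_on U f -> smooth_on U (bdx mu f).
Proof. exact: smooth_on_derive. Qed.

Lemma smooth_on_ap_canonical al mu nu : smooth_on U (G al mu nu).
Proof.
apply: smooth_on_sum => // r; apply: smooth_onM => //.
exact/smooth_on_bdx/smooth_on_bcolam.
Qed.

Lemma smooth_on_ap_metric i j : smooth_on U (ap_metric L i j).
Proof.
by apply: smooth_on_sum => // r; apply: smooth_onM => //; exact: smooth_on_bcolam.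
Qed.

Lemma smooth_on_ap_metric_inv i j : smooth_on U (ap_metric_inv L i j).
Proof.
have s : smooth_on U (fun z => \sum_r L z r i * L z r j).
  by apply: smooth_on_sum => // r; apply: smooth_onM.
apply: smooth_on_eq s => // z Uz; rewrite /ap_metric_inv invmx_gram; last exact: fL.
by rewrite mxE; apply: eq_bigr => r _; rewrite mxE.
Qed.

Lemma smooth_on_ap_conn s al mu nu : smooth_on U (ap_conn L s al mu nu).
Proof.
have cst r : smooth_on U (fun=> r) := smooth_on_cst U r.
case: s; rewrite /ap_conn; try exact: smooth_on_ap_canonical.
  apply: smooth_onM => //; apply: smooth_onD => //; exact: smooth_on_ap_canonical.
apply: smooth_onM => //; apply: smooth_on_sum => // e; apply: smooth_onM => //.
  exact: smooth_on_ap_metric_inv.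
have dg i j k : smooth_on U (bdx i (ap_metric L j k)).
  exact/smooth_on_bdx/smooth_on_ap_metric.
apply: smooth_onD => //; first exact: smooth_onD.
apply: smooth_on_eq (smooth_onM oU (cst (-1)) (dg e mu nu)) => // z _.
by rewrite mulN1r.
Qed.

(** The coframe is parallel for the canonical connection: multiplying the definition of G by the
    coframe cancels the frame. *)
Lemma bdx_bcolam l r j x : U x ->
  bdx l (K r j) x = \sum_i K r i x * G i j l x.
Proof.
move=> Ux; under eq_bigr do rewrite mulr_sumr.
rewrite exchange_big /= (bigD1 r)//= [X in _ + X]big1 ?addr0 => [|s sr].
  under eq_bigr do rewrite mulrA [K _ _ _ * _]mulrC.
  by rewrite -mulr_suml sum_invmxr ?eqxx ?mul1r//; exact: fL.
under eq_bigr do rewrite mulrA [K _ _ _ * _]mulrC.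
by rewrite -mulr_suml sum_invmxr ?(negPf sr) ?mul0r//; exact: fL.
Qed.

(** The frame is parallel too: differentiate the duality sum_a lambda_r^a lambda_(s a) = delta_rs,
    then invert the coframe. *)
Lemma bdx_lam l r i x : U x ->
  bdx l (fun z => L z r i) x = - \sum_e L x r e * G i e l x.
Proof.
move=> Ux; have dL s : \sum_a bdx l (fun z => L z r a) x * K s a x =
    - \sum_a L x r a * bdx l (K s a) x.
  apply/eqP; rewrite -subr_eq0 opprK -big_split /=.
  rewrite -(derive_sumM (f := fun a z => L z r a) (g := fun a => K s a) _
    (sL r) (smooth_on_bcolam s) Ux).
  rewrite (@derive_eq_on _ _ U _ (fun=> (r == s)%:R)) ?derive_cst// => z Uz.
  by rewrite sum_invmxr//; exact: fL.
have -> : bdx l (fun z => L z r i) x =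
    \sum_s (\sum_a bdx l (fun z => L z r a) x * K s a x) * L x s i.
  under eq_bigr do rewrite mulr_suml.
  rewrite exchange_big /= (bigD1 i)//= [X in _ + X]big1 ?addr0 => [|a ai].
    under eq_bigr do rewrite -mulrA [K _ _ _ * _]mulrC.
    by rewrite -mulr_sumr sum_invmxl ?eqxx ?mulr1//; exact: fL.
  under eq_bigr do rewrite -mulrA [K _ _ _ * _]mulrC.
  by rewrite -mulr_sumr sum_invmxl 1?eq_sym ?(negPf ai) ?mulr0//; exact: fL.
under eq_bigr do rewrite dL mulNr mulr_suml.
rewrite sumrN exchange_big /=; congr (- _); apply: eq_bigr => a _.
by rewrite mulr_sumr; apply: eq_bigr => s _; ring.
Qed.

(** Metricity of the canonical connection, inherited from the parallel coframe. *)
Lemma bdx_ap_metric l b c x : U x ->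
  bdx l (ap_metric L b c) x =
  \sum_e (G e b l x * ap_metric L e c x + G e c l x * ap_metric L b e x).
Proof.
move=> Ux; rewrite /bdx (derive_sumM _ (fun r => smooth_on_bcolam r b)
  (fun r => smooth_on_bcolam r c))//.
have -> : \sum_i ('D_(delta_mx 0 l) (K i b) x * K i c x +
    K i b x * 'D_(delta_mx 0 l) (K i c) x) =
   \sum_i \sum_e (K i e x * G e b l x * K i c x + K i b x * (K i e x * G e c l x)).
  apply: eq_bigr => r _; rewrite -!/(bdx _ _ _) !bdx_bcolam//.
  by rewrite mulr_suml mulr_sumr -big_split.
rewrite exchange_big /=; apply: eq_bigr => e _.
rewrite /ap_metric !mulr_sumr -big_split; apply: eq_bigr => r _ /=; ring.
Qed.

(** Differentiating the equation of a parallel coframe once more expresses its second derivatives by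
    the coframe contracted with dG + GG. The antisymmetric part is the coframe contracted with the
    curvature, and the coframe is invertible. *)
Lemma curv_coef_canonical al be mu nu x : U x ->
  curv_coef (fun i j l => G i j l x)
            (fun i j l m => bdx m (G i j l) x) al be mu nu = 0.
Proof.
move=> Ux; have d2 r i j : bdx j (bdx i (K r be)) x =
    \sum_a K r a x * (bdx j (G a be i) x + \sum_e G e be i x * G a e j x).
  rewrite /bdx (@derive_eq_on _ _ U _ (fun z => \sum_a K r a z * G a be i z))//;
    last by move=> z Uz; exact: bdx_bcolam.
  rewrite (derive_sumM _ (smooth_on_bcolam r) (fun a => smooth_on_ap_canonical a be i))//.
  rewrite big_split /= addrC [RHS](eq_bigr _ (fun a _ => mulrDr _ _ _)) big_split /=.
  congr (_ + _); under [RHS]eq_bigr do rewrite mulr_sumr.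
  rewrite [RHS]exchange_big; apply: eq_bigr => a _ /=.
  rewrite -/(bdx _ _ _) bdx_bcolam// mulr_suml; apply: eq_bigr => e _; ring.
move: al; apply: (bcolam_inj Ux) => r.
have : bdx mu (bdx nu (K r be)) x - bdx nu (bdx mu (K r be)) x = 0.
  apply/eqP; rewrite subr_eq0; apply/eqP.
  exact: derive_comm oU (smooth_on_bcolam r be) Ux.
rewrite !d2 -sumrB => h; rewrite -[RHS]h; apply: eq_bigr => a _.
by rewrite /curv_coef -mulrBr opprD addrACA.
Qed.

Lemma bdx_sub f g l x : U x -> smooth_on U f -> smooth_on U g ->
  bdx l (fun z => f z - g z) x = bdx l f x - bdx l g x.
Proof. by move=> Ux sf sg; exact: derive_subE sf sg Ux. Qed.

Lemma bcov10_canonical r i l x : U x ->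
  bcov10 G (fun j z => L z r j) i l x = 0.
Proof. by move=> Ux; rewrite /bcov10 bdx_lam// addNr. Qed.

(** Ricci identity for a connection with torsion; the last sum stems from the lower index created by
    the first differentiation. *)
Lemma bcov11_comm (D : bconn R n) r al nu mu x : U x ->
  (forall i j k, smooth_on U (D i j k)) ->
  let lr := fun j z => L z r j in
  bcov11 D (bcov10 D lr) al nu mu x - bcov11 D (bcov10 D lr) al mu nu x =
  \sum_e L x r e * curv_coef (fun i j l => D i j l x)
                             (fun i j l m => bdx m (D i j l) x) al e mu nu
  - \sum_e bcov10 D lr al e x * (D e nu mu x - D e mu nu x).
Proof.
move=> Ux sD lr; have sl i : smooth_on U (lr i) by exact: sL.
have d i j : bdx j (bcov10 D lr al i) x = bdx j (bdx i (lr al)) x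
    + (\sum_e bdx j (lr e) x * D al e i x + \sum_e lr e x * bdx j (D al e i) x).
  rewrite {1}/bdx /bcov10 (derive_addE (O := U))//; last first.
  - by apply: smooth_on_sum => // e; exact: smooth_onM.
  - exact: smooth_on_bdx.
  rewrite (derive_sumM (O := U) (f := lr))//; first by rewrite big_split.
have s i j : \sum_e bcov10 D lr e i x * D al e j x =
   \sum_e bdx i (lr e) x * D al e j x
   + \sum_e lr e x * \sum_f D f e i x * D al f j x.
  rewrite /bcov10 sum_mulDl; congr (_ + _).
  under eq_bigr do rewrite mulr_suml.
  rewrite exchange_big; apply: eq_bigr => e _ /=; rewrite mulr_sumr.
  by apply: eq_bigr => f _; rewrite mulrA.
have dC : bdx mu (bdx nu (lr al)) x = bdx nu (bdx mu (lr al)) x.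
  exact: derive_comm oU (sl al) Ux.
have d1 := d nu mu; rewrite dC in d1.
by rewrite /bcov11 (ricci_sums _ _ _ d1 (d mu nu) (s nu mu) (s mu nu)).
Qed.

Lemma ap_levi_civita_sym al mu nu :
  ap_levi_civita L al mu nu = ap_levi_civita L al nu mu.
Proof.
have gC i j : ap_metric L i j = ap_metric L j i.
  by apply/funext => z; exact: sum_mulC.
apply/funext => z; rewrite /ap_levi_civita; congr (_ * _).
by apply: eq_bigr => e _; rewrite (gC mu nu); ring.
Qed.

Lemma bcurvature_canonical al be mu nu x : U x ->
  bcurvature (ap_conn L cn_canonical) al be mu nu x = 0.
Proof. by move=> Ux; rewrite bcurvatureE; exact: curv_coef_canonical. Qed.

(** Routed through [cov_coef] so that the algebraic curvature identities apply at each point. *)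
Definition bcov12 (D : bconn R n) (T : I -> I -> I -> 'rV[R]_n -> R)
    (i j1 j2 l : I) (x : 'rV[R]_n) : R :=
  cov_coef (fun i j l => D i j l x) (fun i j l => T i j l x)
           (fun i j l m => bdx m (T i j l) x) i j1 j2 l.

Local Notation Lam := (ap_torsion L).
Local Notation gam := (ap_contortion L).

Lemma bdx_ap_torsion x : U x ->
  (fun i j l m => bdx m (Lam i j l) x) =
  (fun i j l m => bdx m (G i j l) x - bdx m (G i l j) x).
Proof.
move=> Ux; do 4![apply/funext => ?].
by apply: bdx_sub => //; exact: smooth_on_ap_canonical.
Qed.

Lemma bdx_ap_contortion x : U x ->
  (fun i j l m => bdx m (gam i j l) x) =
  (fun i j l m => bdx m (G i j l) x - bdx m (ap_levi_civita L i j l) x).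
Proof.
move=> Ux; do 4![apply/funext => ?]; apply: bdx_sub => //.
  exact: smooth_on_ap_canonical.
exact: (smooth_on_ap_conn cn_natural).
Qed.

Lemma bcurvature_levi_civita al be mu nu x : U x ->
  bcurvature (ap_conn L cn_natural) al be mu nu x =
  (bcov12 G gam al be mu nu x - bcov12 G gam al be nu mu x)
  + \sum_e (gam e be nu x * gam al e mu x - gam e be mu x * gam al e nu x)
  + \sum_e gam al be e x * Lam e mu nu x.
Proof.
move=> Ux; rewrite bcurvatureE /bcov12 bdx_ap_contortion//.
exact: curv_coef_contortion (curv_coef_canonical al be mu nu Ux).
Qed.

Lemma bcurvature_dual al be mu nu x : U x ->
  bcurvature (ap_conn L cn_dual) al be mu nu x = bcov12 G Lam al nu mu be x.
Proof.
move=> Ux; rewrite bcurvatureE /bcov12 bdx_ap_torsion//.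
by apply: curv_coef_dual => *; exact: curv_coef_canonical.
Qed.

Lemma bcurvature_symmetric al be mu nu x : U x ->
  bcurvature (ap_conn L cn_symmetric) al be mu nu x =
  2^-1 * (bcov12 G Lam al be mu nu x - bcov12 G Lam al be nu mu x)
  + 4^-1 * \sum_e (Lam e be mu x * Lam al nu e x - Lam e be nu x * Lam al mu e x)
  + 2^-1 * \sum_e Lam e mu nu x * Lam al be e x.
Proof.
move=> Ux; rewrite bcurvatureE /bcov12 bdx_ap_torsion//.
rewrite -(curv_coef_symmetric (curv_coef_canonical al be mu nu Ux)).
congr (curv_coef _ _ _ _ _ _); do 4![apply/funext => ?].
have s i j l : smooth_on U (G i j l) by exact: smooth_on_ap_canonical.
rewrite /bdx (derive_scaleE _ _ (smooth_onD oU (s _ _ _) (s _ _ _)) Ux).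
by rewrite (derive_addE _ (s _ _ _) (s _ _ _) Ux).
Qed.

(** Symmetry of the coefficients removes the torsion term of the Ricci identity. The pair nu, mu
    turns into mu, nu because the index differentiated first is the second argument of the
    curvature. *)
Lemma torsion_free_Wtensor s r al nu mu x : s = cn_symmetric \/ s = cn_natural ->
  U x -> let lr := fun j z => L z r j in let D := ap_conn L s in
  bcov11 D (bcov10 D lr) al nu mu x - bcov11 D (bcov10 D lr) al mu nu x =
  \sum_be L x r be * bcurvature D al be mu nu x.
Proof.
move=> hs Ux lr D.
rewrite (bcov11_comm r al nu mu Ux (@smooth_on_ap_conn s)).
rewrite [X in _ - X]big1 ?subr0 => [|e _].
  by apply: eq_bigr => be _; rewrite bcurvatureE.
rewrite (_ : ap_conn L s e nu mu x = ap_conn L s e mu nu x) ?subrr ?mulr0//.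
by case: hs => -> /=; [rewrite addrC|rewrite ap_levi_civita_sym].
Qed.

Lemma bcov10_dual r i l x : U x ->
  bcov10 (ap_conn L cn_dual) (fun j z => L z r j) i l x =
  \sum_e L x r e * (G i l e x - G i e l x).
Proof. by move=> Ux; rewrite /bcov10 bdx_lam// sum_mulBr addrC. Qed.

(** Since the frame is canonically parallel, its dual covariant derivative is a contraction with
    Lambda^al_(e be). The dual torsion is minus Lambda, so the torsion term of the Ricci identity
    enters with a plus sign and with this order of lower indices. *)
Lemma dual_Wtensor r al nu mu x :
  U x -> let lr := fun j z => L z r j in let D := ap_conn L cn_dual in
  bcov11 D (bcov10 D lr) al nu mu x - bcov11 D (bcov10 D lr) al mu nu x =
  \sum_be L x r be * (bcov12 G Lam al nu mu be x
                      + \sum_e Lam e nu mu x * Lam al e be x).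
Proof.
move=> Ux lr D.
rewrite (bcov11_comm r al nu mu Ux (@smooth_on_ap_conn cn_dual)).
under [X in _ - X]eq_bigr do rewrite bcov10_dual// mulr_suml.
rewrite [X in _ - X]exchange_big -sumrB /=; apply: eq_bigr => be _.
rewrite -bcurvature_dual// bcurvatureE.
rewrite [RHS]mulrDr; congr (_ + _); rewrite mulr_sumr -sumrN.
by apply: eq_bigr => e _; rewrite /D /= /ap_torsion; ring.
Qed.

End Base.

(** * Lifts to TM *)

Section AdaptedFrame.
Context {R : realType} {n : nat}.
Local Notation I := 'I_n.
Local Notation TM := ('rV[R]_n * 'rV[R]_n)%type.
Context (N : TM -> 'M[R]_n).
Implicit Types (D : dconn R n) (X Y Z : vfield R n) (p : TM).

Lemma of_adaptedK X : adapted N (of_adapted N X) = X.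
Proof.
by apply/funext => -[]//; apply/funext => i; apply/funext => p /=; rewrite subrK.
Qed.

Lemma vact_cst X (r : R) : vact X (fun=> r) = fun=> 0.
Proof.
apply/funext => p; rewrite /vact !big1 ?addr0// => i _.
  by rewrite /dy derive_cst mulr0.
by rewrite /dx derive_cst mulr0.
Qed.

Lemma vact_frame_field d l f : vact (frame_field N d l) f = fr N d l f.
Proof.
apply/funext => p; rewrite /vact /frame_field /of_adapted; case: d => /=.
  rewrite sum_delta_l; congr (_ + _); rewrite -sumrN; apply: eq_bigr => a _.
  by rewrite sum_delta_r sub0r mulNr.
rewrite big1 ?add0r => [|i _]; last by rewrite mul0r.
under eq_bigr => a _.
  rewrite [X in _ - X]big1 => [|i _]; last by rewrite mulr0.
  rewrite subr0; over.
by rewrite sum_delta_l.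
Qed.

Lemma adapted_nabla D X Y k i p :
  adapted N (nabla N D X Y) k i p = vact X (adapted N Y k i) p
    + \sum_j adapted N Y k j p *
        (\sum_l adapted N X hor l p * D k hor i j l p
         + \sum_l adapted N X ver l p * D k ver i j l p).
Proof. by rewrite of_adaptedK. Qed.

Lemma adapted_nabla_frame D d l Y k i p :
  adapted N (nabla N D (frame_field N d l) Y) k i p =
  fr N d l (adapted N Y k i) p + \sum_j adapted N Y k j p * D k d i j l p.
Proof.
rewrite adapted_nabla vact_frame_field of_adaptedK; congr (_ + _).
apply: eq_bigr => j _; congr (_ * _); case: d.
  by rewrite sum_delta_l big1 ?addr0// => e _; rewrite mul0r.
by rewrite sum_delta_l big1 ?add0r// => e _; rewrite mul0r.
Qed.

Lemma frame_fieldK k j i : adapted N (frame_field N k j) k i = fun=> (i == j)%:R.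
Proof. by rewrite of_adaptedK; case: k. Qed.

Lemma adapted_nabla_frames D k d m j i :
  adapted N (nabla N D (frame_field N d m) (frame_field N k j)) k i = D k d i j m.
Proof.
apply/funext => p; rewrite adapted_nabla_frame -vact_frame_field frame_fieldK.
rewrite vact_cst add0r.
by under eq_bigr do rewrite frame_fieldK; rewrite sum_delta_l.
Qed.

(** Adapted fields have constant horizontal components, so their bracket is vertical; the vanishing
    of the v-coefficients then removes the bracket term. *)
Lemma curvatureE D k d1 d2 i j l m p :
  (forall c, D k ver i j c p = 0) ->
  curvature N D k d1 d2 i j l m p =
  fr N d1 l (D k d2 i j m) p - fr N d2 m (D k d1 i j l) p
  + (\sum_e D k d2 e j m p * D k d1 i e l p
     - \sum_e D k d1 e j l p * D k d2 i e m p).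
Proof.
move=> D0; rewrite /curvature /curvature_op.
set F := frame_field N; set X := nabla N D (F d1 l) _.
set Y := nabla N D (F d2 m) _; set Z := nabla N D (bracket _ _) _.
have -> : adapted N (fun k i p => X k i p - Y k i p - Z k i p) k i p =
    adapted N X k i p - adapted N Y k i p - adapted N Z k i p.
  rewrite /adapted; case: k @X @Y @Z {D0} => X Y Z //.
  under eq_bigr do rewrite !mulrBr.
  by rewrite !sumrB; ring.
have -> : adapted N Z k i p = 0.
  rewrite adapted_nabla frame_fieldK vact_cst add0r.
  under eq_bigr do rewrite frame_fieldK.
  rewrite sum_delta_l [X in _ + X]big1 ?addr0 => [|c _]; last by rewrite D0 mulr0.
  rewrite big1// => a _; rewrite (_ : adapted _ _ _ _ _ = 0) ?mul0r//.
  rewrite /= /bracket.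
  have hc d e b : F d e hor b = fun=> (match d with hor => (b == e)%:R | ver => 0 end).
    by apply/funext => q; rewrite /F /frame_field /=; case: d.
  by rewrite !hc !vact_cst subrr.
rewrite !adapted_nabla_frame !adapted_nabla_frames.
under eq_bigr do rewrite adapted_nabla_frames.
under [X in _ - (_ + X)]eq_bigr do rewrite adapted_nabla_frames.
by rewrite subr0 opprD addrACA.
Qed.

End AdaptedFrame.

(** * Geometry on TM when the frame depends on x only *)

Section Lift.
Context {R : realType} {n : nat}.
Local Notation I := 'I_n.
Local Notation TM := ('rV[R]_n * 'rV[R]_n)%type.
Implicit Types (p q : TM).

Lemma derive_fst (g : 'rV[R]_n -> R) p (v : TM) :
  'D_v (fun q => g q.1) p = 'D_(v.1) g p.1.
Proof. by []. Qed.

Lemma is_derive_fst (g : 'rV[R]_n -> R) p (v : TM) d :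
  is_derive p.1 v.1 g d -> is_derive p v (fun q : TM => g q.1) d.
Proof. by case=> dg dE; apply: DeriveDef. Qed.

Lemma is_derive_ycoord (b : I) p (v : TM) :
  is_derive p v (fun q : TM => q.2 0 b) (v.2 0 b).
Proof.
have E : \forall h \near (0 : R)^', (v.2 0 b : R) =
    h^-1 *: (((fun q : TM => q.2 0 b) \o shift p) (h *: v) - p.2 0 b).
  near=> h; rewrite /= !mxE addrK [_ *: _]mulrA mulVf ?mul1r//.
  by near: h; exact: nbhs_dnbhs_neq.
have C : (fun h => h^-1 *: (((fun q : TM => q.2 0 b) \o shift p) (h *: v)
    - p.2 0 b)) @ (0 : R)^' --> (v.2 0 b : R).
  exact: cvg_trans (near_eq_cvg E) (cvg_cst _).
apply: DeriveDef; first by apply/cvg_ex; exists (v.2 0 b).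
exact: cvg_lim C.
Unshelve. all: by end_near. Qed.

Lemma smooth_on_ycoord (O : set TM) (b : I) : smooth_on O (fun q : TM => q.2 0 b).
Proof.
have c p : {for p, continuous (fun q : TM => q.2 0 b)}.
  apply: (@continuous_comp _ _ _ snd (fun y : 'rV[R]_n => y 0 b)).
    exact: cvg_snd.
  exact: coord_continuous.
case=> [|k]; split=> // v; split=> [p _|]; first by case: (is_derive_ycoord b p v).
rewrite (_ : 'D_v _ = fun=> v.2 0 b); first exact: smooth_on_cst.
by apply/funext => p; case: (is_derive_ycoord b p v).
Qed.

Lemma sum_mul_eq0 (y a b c d : I -> R) :
  (forall e, a e - b e - (c e - d e) = 0) ->
  \sum_e y e * a e - \sum_e y e * b e - (\sum_e y e * c e - \sum_e y e * d e) = 0.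
Proof. by move=> h; rewrite -!sum_mulBr big1// => e _; rewrite h mulr0. Qed.

Context {U : set 'rV[R]_n} (oU : open U).
Local Notation O := [set p : TM | U p.1].

Lemma open_fst : open O.
Proof. by apply: (open_comp (f := fst)) oU => p _; exact: cvg_fst. Qed.

Definition lifts_on (f : TM -> R) (g : 'rV[R]_n -> R) : Prop :=
  forall p, U p.1 -> f p = g p.1.

Lemma dx_lift f g mu p : lifts_on f g -> U p.1 -> dx mu f p = bdx mu g p.1.
Proof.
move=> fg Up; rewrite /dx (derive_eq_on _ open_fst Up fg).
exact: derive_fst.
Qed.

Lemma dy_lift f g a p : lifts_on f g -> U p.1 -> dy a f p = 0.
Proof.
move=> fg Up; rewrite /dy (derive_eq_on _ open_fst Up fg).
by rewrite derive_fst /= derive0.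
Qed.

(** The N-part of delta_mu consists of y-derivatives, which annihilate a lift. *)
Lemma fr_hor_lift N f g mu p : lifts_on f g -> U p.1 ->
  fr N hor mu f p = bdx mu g p.1.
Proof.
move=> fg Up; rewrite /= (dx_lift _ fg Up) big1 ?subr0// => a _.
by rewrite (dy_lift _ fg Up) mulr0.
Qed.

Lemma fr_zero N d l f p : (forall q, U q.1 -> f q = 0) -> U p.1 ->
  fr N d l f p = 0.
Proof.
move=> f0 Up; have fg : lifts_on f (fun=> 0) by move=> q /f0.
case: d; first by rewrite (fr_hor_lift _ _ fg Up) /bdx derive_cst.
exact: dy_lift fg Up.
Qed.

Context (N : TM -> 'M[R]_n) (L : kind -> TM -> 'M[R]_n).
Context (A : kind -> 'rV[R]_n -> 'M[R]_n).
Context (sA : forall k i j, smooth_on U (fun x => A k x i j))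
        (fA : forall k x, U x -> row_free (A k x)).
Context (LA : forall k p, U p.1 -> L k p = A k p.1).
Context (NA : forall a mu p, U p.1 ->
  N p a mu = \sum_b p.2 0 b * ap_canonical (A ver) a b mu p.1).

(** A single vertical branch, since the four connections share Gamma^a_(b mu). *)
Definition base_conn (s : stdconn) (k : kind) : bconn R n :=
  match k with hor => ap_conn (A hor) s | ver => ap_canonical (A ver) end.

Lemma colam_lift k i j : lifts_on (colam L k i j) (bcolam (A k) i j).
Proof. by move=> p Up; rewrite /colam /bcolam LA. Qed.

Lemma metric_lift k i j : lifts_on (metric L k i j) (ap_metric (A k) i j).
Proof. by move=> p Up; apply: eq_bigr => r _; rewrite !colam_lift. Qed.

Lemma metric_inv_lift k i j :
  lifts_on (metric_inv L k i j) (ap_metric_inv (A k) i j).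
Proof.
move=> p Up; rewrite /metric_inv /ap_metric_inv; congr (invmx _ _ _).
by apply/matrixP => u v; rewrite !mxE metric_lift.
Qed.

Lemma canonical_conn_hor k i j l :
  lifts_on (canonical_conn N L k hor i j l) (ap_canonical (A k) i j l).
Proof.
move=> p Up; apply: eq_bigr => r _.
by rewrite (fr_hor_lift _ _ (colam_lift k r j) Up) LA.
Qed.

Lemma canonical_conn_ver k i j l p : U p.1 -> canonical_conn N L k ver i j l p = 0.
Proof.
move=> Up; rewrite /canonical_conn big1// => r _.
by rewrite /= (dy_lift _ (colam_lift k r j) Up) mulr0.
Qed.

Lemma dy_N b a nu p : U p.1 ->
  dy b (fun q => N q a nu) p = ap_canonical (A ver) a b nu p.1.
Proof.
move=> Up; rewrite /dy (derive_eq_on _ open_fst Up (NA a nu)).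
set g := fun e (q : TM) => ap_canonical (A ver) a e nu q.1.
suff [] : is_derive p ((0, delta_mx 0 b) : TM)
   (fun q => \sum_e q.2 0 e * g e q)
   (\sum_e ((delta_mx 0 b : 'rV[R]_n) 0 e * g e p + p.2 0 e * 0)).
  move=> _ ->; under eq_bigr do rewrite mulr0 addr0 mxE eqxx /=.
  exact: sum_delta_l.
apply: is_derive_sum_fun => e; apply: is_deriveM_fun.
  exact: is_derive_ycoord.
apply: is_derive_fst; exact: is_derive0.
Qed.

Lemma dx_N a mu nu p : U p.1 ->
  dx nu (fun q => N q a mu) p =
  \sum_b p.2 0 b * bdx nu (ap_canonical (A ver) a b mu) p.1.
Proof.
move=> Up; rewrite /dx (derive_eq_on _ open_fst Up (NA a mu)).
set g := fun e => ap_canonical (A ver) a e mu.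
suff [] : is_derive p ((delta_mx 0 nu, 0) : TM)
   (fun q => \sum_e q.2 0 e * g e q.1)
   (\sum_e ((0 : 'rV[R]_n) 0 e * g e p.1 + p.2 0 e * bdx nu (g e) p.1)).
  by move=> _ ->; apply: eq_bigr => e _; rewrite mxE mul0r add0r.
apply: is_derive_sum_fun => e; apply: is_deriveM_fun.
  exact: is_derive_ycoord.
apply: is_derive_fst; apply: smooth_on_is_derive Up.
exact: (smooth_on_ap_canonical oU (sA ver) (fA ver)).
Qed.

(** N is linear in y, so R^a_(mu nu) is y^b times the curvature of the vertical canonical
    connection, which is flat. *)
Lemma torsion_R_eq0 a mu nu p : U p.1 -> torsion_R N a mu nu p = 0.
Proof.
move=> Up; rewrite /torsion_R /= !dx_N//.
have G mu' nu' : \sum_c N p c nu' * dy c (fun q => N q a mu') p =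
    \sum_b p.2 0 b * \sum_c ap_canonical (A ver) c b nu' p.1 *
       ap_canonical (A ver) a c mu' p.1.
  under eq_bigr do rewrite dy_N// NA// mulr_suml.
  rewrite exchange_big; apply: eq_bigr => b _ /=; rewrite mulr_sumr.
  by apply: eq_bigr => c _; rewrite mulrA.
rewrite (G mu nu) (G nu mu); apply: sum_mul_eq0 => b.
rewrite -[RHS](curv_coef_canonical oU (sA ver) (fA ver) a b nu mu Up).
by rewrite /curv_coef opprD opprK addrACA; congr (_ + _); exact: addrC.
Qed.

(** Once d/dy^b N^d_nu is replaced by Gamma^d_(b nu), the parenthesis in the natural connection is
    the covariant derivative of the vertical metric, zero by metricity. *)
Lemma natural_ver_hor a b nu p : U p.1 ->
  natural_metric_conn N L ver hor a b nu p = ap_canonical (A ver) a b nu p.1.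
Proof.
move=> Up; rewrite /natural_metric_conn dy_N// big1 ?mulr0 ?addr0// => c _.
rewrite (fr_hor_lift _ _ (metric_lift ver b c) Up) (bdx_ap_metric oU (sA ver) (fA ver))//.
rewrite -addrA -opprD -big_split /= -sumrB big1 ?mulr0// => e _.
by rewrite !dy_N// !metric_lift//; ring.
Qed.

Lemma std_dconn_hor s k i j l :
  lifts_on (std_dconn N L s k hor i j l) (base_conn s k i j l).
Proof.
move=> p Up; case: s; case: k => /=; try exact: canonical_conn_hor.
- by rewrite !canonical_conn_hor.
- rewrite /ap_levi_civita; congr (_ * _); apply: eq_bigr => e _.
  rewrite metric_inv_lift//; congr (_ * (_ + _ - _));
    exact: fr_hor_lift (metric_lift _ _ _) Up.
- exact: natural_ver_hor.
Qed.

Lemma std_dconn_ver s k i j l p : U p.1 -> std_dconn N L s k ver i j l p = 0.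
Proof.
move=> Up; case: s; case: k => /=; try exact: canonical_conn_ver.
- by rewrite !canonical_conn_ver// addr0 mulr0.
- by rewrite big1 ?mulr0// => e _; rewrite (dy_lift _ (metric_lift _ _ _) Up) mulr0.
- rewrite big1 ?mulr0// => e _; rewrite !(dy_lift _ (metric_lift _ _ _) Up).
  by rewrite addr0 subr0 mulr0.
Qed.

Lemma curvature_hor_hor s k i j l m :
  lifts_on (curvature N (std_dconn N L s) k hor hor i j l m)
           (bcurvature (base_conn s k) i j l m).
Proof.
move=> p Up; rewrite bcurvatureE curvatureE; last by move=> c; exact: std_dconn_ver.
rewrite !(fr_hor_lift _ _ (std_dconn_hor s k _ _ _) Up) /curv_coef.
by congr (_ + (_ - _)); apply: eq_bigr => e _; rewrite !std_dconn_hor.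
Qed.

(** With a vertical direction present, each term contains a v-coefficient, hence 0, or the
    y-derivative of a lift. *)
Lemma curvature_vanishes s k d1 d2 i j l m p : (d1, d2) <> (hor, hor) -> U p.1 ->
  curvature N (std_dconn N L s) k d1 d2 i j l m p = 0.
Proof.
move=> d12 Up; rewrite curvatureE; last by move=> c; exact: std_dconn_ver.
have v0 i' j' l' q : U q.1 -> std_dconn N L s k ver i' j' l' q = 0.
  exact: std_dconn_ver.
have dv d e i' j' l' m' : (d, e) <> (hor, hor) ->
    fr N d m' (std_dconn N L s k e i' j' l') p = 0.
  case: e => [|_]; last by apply: fr_zero Up => q; exact: v0.
  by case: d => // _; exact: dy_lift (std_dconn_hor s k i' j' l') Up.
rewrite !dv//; last by case=> e2 e1; apply: d12; rewrite e1 e2.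
rewrite !big1 ?subrr ?addr0// => e _.
  by case: d1 d12; case: d2 => // _; rewrite v0// ?mul0r ?mulr0.
by case: d1 d12; case: d2 => // _; rewrite v0// ?mul0r ?mulr0.
Qed.

Lemma curvature_ver s d1 d2 i j l m p : U p.1 ->
  curvature N (std_dconn N L s) ver d1 d2 i j l m p = 0.
Proof.
move=> Up; case: d1; case: d2; try exact: curvature_vanishes.
rewrite curvature_hor_hor//=.
exact: (bcurvature_canonical oU (sA ver) (fA ver)).
Qed.

Lemma cov10_hor s k r i l :
  lifts_on (cov10 N (std_dconn N L s) hor k (fun j q => L k q r j) i l)
           (bcov10 (base_conn s k) (fun j z => A k z r j) i l).
Proof.
have Ll j : lifts_on (fun q => L k q r j) (fun z => A k z r j).
  by move=> q Uq; rewrite LA.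
move=> p Up; rewrite /cov10 (fr_hor_lift _ _ (Ll i) Up); congr (_ + _).
by apply: eq_bigr => e _; rewrite Ll// std_dconn_hor.
Qed.

Lemma cov10_ver s k r i l p : U p.1 ->
  cov10 N (std_dconn N L s) ver k (fun j q => L k q r j) i l p = 0.
Proof.
have Ll j : lifts_on (fun q => L k q r j) (fun z => A k z r j).
  by move=> q Uq; rewrite LA.
move=> Up; rewrite /cov10 /= (dy_lift _ (Ll i) Up) add0r big1// => e _.
by rewrite std_dconn_ver ?mulr0.
Qed.

Lemma cov11_zero D d k k1 T i j l p :
  (forall i j q, U q.1 -> T i j q = 0) -> U p.1 ->
  cov11 N D d k k1 T i j l p = 0.
Proof.
move=> T0 Up; rewrite /cov11 (fr_zero _ _ _ (T0 i j) Up) add0r.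
by rewrite !big1 ?subrr// => e _; rewrite T0// mul0r.
Qed.

Lemma cov11_ver s k k1 T T0 i j l p :
  (forall i j, lifts_on (T i j) (T0 i j)) -> U p.1 ->
  cov11 N (std_dconn N L s) ver k k1 T i j l p = 0.
Proof.
move=> TT0 Up; rewrite /cov11 /= (dy_lift _ (TT0 i j) Up) add0r.
by rewrite !big1 ?subrr// => e _; rewrite std_dconn_ver ?mulr0.
Qed.

Lemma cov11_hor s T T0 i j l : (forall i j, lifts_on (T i j) (T0 i j)) ->
  lifts_on (cov11 N (std_dconn N L s) hor hor hor T i j l)
           (bcov11 (ap_conn (A hor) s) T0 i j l).
Proof.
move=> TT0 p Up; rewrite /cov11 /bcov11 (fr_hor_lift _ _ (TT0 i j) Up).
by congr (_ + _ - _); apply: eq_bigr => e _; rewrite TT0// std_dconn_hor.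
Qed.

Lemma cov12_hor T T0 i j1 j2 l : (forall i j l, lifts_on (T i j l) (T0 i j l)) ->
  lifts_on (cov12 N (std_dconn N L cn_canonical) hor hor hor hor T i j1 j2 l)
           (bcov12 (ap_canonical (A hor)) T0 i j1 j2 l).
Proof.
move=> TT0 p Up; rewrite /cov12 /bcov12 /cov_coef.
rewrite (fr_hor_lift _ _ (TT0 _ _ _) Up).
by congr (_ + _ - _ - _); apply: eq_bigr => e _; rewrite TT0// std_dconn_hor.
Qed.

(** For the canonical connection or the vertical kind the frame is parallel. Otherwise one direction
    is vertical, and each iterated derivative dies either at the inner v-derivative or, its inner
    part being a lift, at the outer one. *)
Lemma Wtensor_vanishes s k d1 d2 r i l m p :
  s = cn_canonical \/ (k, d1, d2) <> (hor, hor, hor) -> U p.1 ->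
  let D := std_dconn N L s in let lr := fun j q => L k q r j in
  cov11 N D d2 k d1 (cov10 N D d1 k lr) i l m p
  - cov11 N D d1 k d2 (cov10 N D d2 k lr) i m l p = 0.
Proof.
move=> sk Up D lr.
have Z d i' j' q : d = ver \/ (s = cn_canonical \/ k = ver) -> U q.1 ->
    cov10 N D d k lr i' j' q = 0.
  move=> h Uq; case: d h => [h|_]; last exact: cov10_ver.
  rewrite cov10_hor//; case: h => // h; case: k lr sk h => lr sk h.
    case: h => // ->; exact: (bcov10_canonical oU (sA hor) (fA hor)).
  exact: (bcov10_canonical oU (sA ver) (fA ver)).
have main d d' i' l' m' : d = ver \/ d' = ver \/ (s = cn_canonical \/ k = ver) ->
    cov11 N D d' k d (cov10 N D d k lr) i' l' m' p = 0.
  move=> h; case: d h => [h|_]; last first.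
    by apply: cov11_zero Up => *; apply: Z => //; left.
  case: d' h => [h|_]; last by apply: cov11_ver Up => *; exact: cov10_hor.
  apply: cov11_zero Up => *; apply: Z => //; case: h => //; case=> //; by right.
have h : d1 = ver \/ d2 = ver \/ (s = cn_canonical \/ k = ver).
  case: sk => [->|h]; first by do 2!right; left.
  case: d1 h; [|by left]; case: d2; [|by right; left].
  by case: k {lr Z main} => // h; do 3!right.
rewrite !main ?subrr//; case: h; tauto.
Qed.

Lemma Wtensor_hor s r i l m :
  let D := std_dconn N L s in let lr := fun j q => L hor q r j in
  let D0 := ap_conn (A hor) s in let lr0 := fun j z => A hor z r j in
  lifts_on (fun p => cov11 N D hor hor hor (cov10 N D hor hor lr) i l m p
              - cov11 N D hor hor hor (cov10 N D hor hor lr) i m l p)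
           (fun x => bcov11 D0 (bcov10 D0 lr0) i l m x
              - bcov11 D0 (bcov10 D0 lr0) i m l x).
Proof.
move=> D lr D0 lr0 p Up.
have c i' j' : lifts_on (cov10 N D hor hor lr i' j') (bcov10 D0 lr0 i' j').
  exact: cov10_hor.
by rewrite (cov11_hor s _ _ _ c)// (cov11_hor s _ _ _ c).
Qed.

Lemma torsion_Lambda_lift i j l :
  lifts_on (torsion_Lambda (std_dconn N L cn_canonical) i j l)
           (ap_torsion (A hor) i j l).
Proof. by move=> p Up; rewrite /torsion_Lambda !std_dconn_hor. Qed.

Lemma contortion_hor_hor i j l :
  lifts_on (contortion N L hor hor i j l) (ap_contortion (A hor) i j l).
Proof.
move=> p Up; congr (_ - _); first exact: (std_dconn_hor cn_canonical hor).
exact: (std_dconn_hor cn_natural hor).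
Qed.

End Lift.

(** * Independence of y under the CB-condition *)

Section VerticalIndependence.
Context {R : realType} {n : nat} {U : set 'rV[R]_n} (oU : open U).
Local Notation I := 'I_n.
Local Notation TM := ('rV[R]_n * 'rV[R]_n)%type.
Local Notation O := [set p : TM | U p.1].
Context (N : TM -> 'M[R]_n) (L : kind -> TM -> 'M[R]_n).
Context (sL : forall k i j, smooth_on O (fun p => L k p i j))
        (fL : forall k p, O p -> row_free (L k p)).

Lemma smooth_on_colam k i j : smooth_on O (colam L k i j).
Proof. exact: smooth_on_invmx (open_fst oU) (fL k) (sL k). Qed.

(* The hypothesis is Euler's relation for degree 0. *)
Lemma homogeneous0_x_only (f : TM -> R) x y : smooth_on O f ->
  (forall p, O p -> \sum_b p.2 0 b * dy b f p = 0) -> U x ->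
  f (x, y) = f (x, 0).
Proof.
move=> sf f0 Ux.
have Ot (t : R) : O (t *: ((0, y) : TM) + (x, 0)).
  by rewrite /= scaler0 add0r.
have -> : (x, y) = (0, y) + (x, 0) :> TM.
  by congr pair; rewrite /= ?add0r ?addr0.
apply: (constant_on_ray sf) => [t _|t /andP[t0 _]]; first exact: Ot.
apply: (mulfI (lt0r_neq0 t0)); rewrite mulr0 -[RHS](f0 _ (Ot t)).
move: (Ot t); set q := t *: _ + _ => Oq.
have -> : (0, y) = \sum_b y 0 b *: ((0, delta_mx 0 b) : TM).
  have F m (c : 'I_m -> R) (e : 'I_m -> 'rV[R]_n) :
      \sum_b c b *: ((0, e b) : TM) = (0, \sum_b c b *: e b).
    elim/big_rec2: _ => [//|b z w _ ->].
    by congr pair; rewrite /= scaler0 addr0.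
  by rewrite F; congr pair; exact: row_sum_delta.
rewrite (derive_dir_sum _ _ (open_fst oU) sf Oq) mulr_sumr.
by apply: eq_bigr => b _; rewrite /q /= !mxE addr0 mulrA.
Qed.

Lemma colam_x_only_lam k x y : U x ->
  (forall r j, colam L k r j (x, y) = colam L k r j (x, 0)) ->
  L k (x, y) = L k (x, 0).
Proof.
move=> Ux h; rewrite -[LHS]invmxK -[RHS]invmxK; congr invmx.
by apply/matrixP => i j; exact: h.
Qed.

(** Cancelling the invertible frame in C^alpha_(mu c) = 0 makes every y-derivative of the horizontal
    coframe vanish, so Euler's relation holds term by term. *)
Lemma lam_hor_x_only x y : U x ->
  (forall al mu c p, O p -> canonical_conn N L hor ver al mu c p = 0) ->
  L hor (x, y) = L hor (x, 0).
Proof.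
move=> Ux C0; apply: (colam_x_only_lam Ux) => r mu.
apply: (homogeneous0_x_only _ (smooth_on_colam hor r mu)) => // p Op.
apply: big1 => c _; rewrite (_ : dy c _ p = 0) ?mulr0//.
move: r; apply: (@sum_row_inj _ _ (L hor p)^T).
  by rewrite row_free_unit unitmx_tr -row_free_unit; exact: fL.
move=> a; rewrite -[RHS](C0 a mu c p Op).
by apply: eq_bigr => s _; rewrite mxE.
Qed.

Lemma lam_ver_x_only x y : U x ->
  (forall a c p, O p ->
     \sum_b p.2 0 b * canonical_conn N L ver ver a b c p = 0) ->
  L ver (x, y) = L ver (x, 0).
Proof.
move=> Ux C0; apply: (colam_x_only_lam Ux) => r c.
pose K := colam L ver.
have sK i j : smooth_on O (K i j) := smooth_on_colam ver i j.
have yK s e p : O p -> \sum_b p.2 0 b * dy e (K s b) p = 0.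
  move=> Op; move: s; apply: (@sum_row_inj _ _ (L ver p)^T).
    by rewrite row_free_unit unitmx_tr -row_free_unit; exact: fL.
  move=> a; rewrite -[RHS](C0 a e p Op).
  under eq_bigr do rewrite mxE mulr_sumr.
  rewrite exchange_big; apply: eq_bigr => b _ /=.
  by rewrite mulr_sumr; apply: eq_bigr => s _; rewrite mulrCA.
pose w (q : TM) := \sum_b q.2 0 b * K r b q.
have sy (b : I) : smooth_on O (fun q : TM => q.2 0 b) := smooth_on_ycoord O b.
have sw : smooth_on O w.
  by apply: smooth_on_sum (open_fst oU) _ => b; apply: smooth_onM (open_fst oU) _ _.
have dw e p : O p -> dy e w p = K r e p.
  move=> Op; rewrite /dy (derive_sumM _ sy (sK r) Op) big_split /= [X in _ + X]yK//.
  rewrite addr0 -[RHS](sum_delta_l (fun b => K r b p)).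
  apply: eq_bigr => b _; case: (is_derive_ycoord b p (0, delta_mx 0 e)) => _ ->.
  by rewrite mxE eqxx.
apply: (homogeneous0_x_only _ (sK r c)) => // p Op.
rewrite -[RHS](yK r c p Op); apply: eq_bigr => b _; congr (_ * _).
rewrite /dy -(derive_eq_on _ (open_fst oU) Op (dw c)).
rewrite -(derive_eq_on _ (open_fst oU) Op (dw b)).
exact: derive_comm (open_fst oU) sw Op.
Qed.

End VerticalIndependence.

(** * The classical AP-space read off along the zero section *)

Section Manifold.
Context {R : realType} {n : nat}.
Local Notation I := 'I_n.
Local Notation TM := ('rV[R]_n * 'rV[R]_n)%type.

Lemma continuous_zero_section (x : 'rV[R]_n) :
  {for x, continuous (fun x : 'rV[R]_n => (x, 0) : TM)}.
Proof.
apply: (@cvg_pair _ _ _ (nbhs x) (nbhs x) (nbhs (0 : 'rV[R]_n)) _ _ _ id (cst 0)).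
  exact: cvg_id.
exact: cvg_cst.
Qed.

(** The derivative of the restriction along [v] is the restriction of the derivative along [(v, 0)],
    so the induction on the order never leaves the zero section. *)
Lemma smooth_on_zero_section (U : set 'rV[R]_n) (f : TM -> R) :
  smooth_on [set p : TM | U p.1] f -> smooth_on U (fun x => f (x, 0)).
Proof.
move=> sf k; move: (sf k) => {sf}; elim: k f => [|k IH] f [cf df].
  split=> // x Ux; apply: (@continuous_comp _ _ _ (fun x => (x, 0) : TM) f).
    exact: continuous_zero_section.
  exact: (cf (x, 0) Ux).
split=> [x Ux|v].
  apply: (@continuous_comp _ _ _ (fun x => (x, 0) : TM) f).
    exact: continuous_zero_section.
  exact: (cf (x, 0) Ux).
have E x : (fun h : R => h^-1 *: (((fun x => f (x, 0)) \o shift x) (h *: v)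
      - f (x, 0))) =
    (fun h : R => h^-1 *: ((f \o shift ((x, 0) : TM)) (h *: ((v, 0) : TM))
      - f (x, 0))).
  apply/funext => h /=; congr (_ *: (f _ - _)).
  by congr pair; rewrite /= scaler0 addr0.
have [df1 df2] := df ((v, 0) : TM); split.
  by move=> x Ux; rewrite /derivable E; exact: df1.
rewrite (_ : 'D_v _ = fun x => 'D_((v, 0) : TM) f (x, 0)); first exact: (IH _ df2).
by apply/funext => x; rewrite /derive E.
Qed.

Context {M : smooth_manifold R n} (E : EAPspace M) (CB : CBcondition E).

Lemma lifts_x_only (c : chart M) f g : lifts c f g -> x_only c f.
Proof. by move=> h x y y' Ux; rewrite !h. Qed.

Definition base_lam (c : chart M) (k : kind) (x : 'rV[R]_n) : 'M[R]_n :=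
  lam E c k (x, 0).

Lemma smooth_on_base_lam c k i j :
  smooth_on (cimage c) (fun x => base_lam c k x i j).
Proof. exact: smooth_on_zero_section (lam_smooth E c k i j). Qed.

Lemma base_lam_free c k x : cimage c x -> row_free (base_lam c k x).
Proof. by move=> Ux; exact: lam_free. Qed.

Lemma base_lamE c k p : tdom c p -> lam E c k p = base_lam c k p.1.
Proof.
case: p => x y Ux; have oU : open (cimage c) := @cimage_open _ _ M c.
have sL k' i j := lam_smooth E c k' i j.
have fL k' p : tdom c p -> row_free (lam E c k' p) by move=> Op; exact: lam_free.
rewrite /base_lam /=; case: k.
  apply: (lam_hor_x_only (N := nlc E c) oU sL fL _ Ux).
  by move=> al mu d p Op; have [_ _ h] := CB Op; exact: h.
apply: (lam_ver_x_only (N := nlc E c) oU sL fL _ Ux) => a d p Op.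
by have [_ h _] := CB Op; exact: h.
Qed.

(** This is the law on TM at [(x, 0)]; [base_lamE] discards the fibre coordinate of the image point,
    so its value never has to be computed. *)
Lemma base_lam_transform c c' i x : overlap c c' x ->
  row i (base_lam c' hor (transition c c' x)) =
  'D_(row i (base_lam c hor x)) (transition c c') x.
Proof.
move=> xo; rewrite -(lam_transform E hor i (p := (x, 0)) xo) base_lamE//.
by case: xo => _ ?; exists (cinv c x).
Qed.

Definition base_APspace : APspace M :=
  APSpace (fun c => smooth_on_base_lam c hor) (fun c => @base_lam_free c hor)
          base_lam_transform.

Lemma ncoefE c a mu p : tdom c p ->
  nlc E c p a mu = \sum_b p.2 0 b * ap_canonical (base_lam c ver) a b mu p.1.
Proof.
move=> Op; have [-> _ _] := CB Op; apply: eq_bigr => b _; congr (_ * _).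
apply: (canonical_conn_hor (@cimage_open _ _ M c)) => // k q Uq; exact: base_lamE.
Qed.

End Manifold.

Theorem theorem7p1 (R : realType) (n : nat) (M : smooth_manifold R n)
    (E : EAPspace M) (CB : CBcondition E) :
  exists A : APspace M,
  (* A is the classical AP-space given by the lambda_i^alpha *)
  (forall c p, tdom c p -> lam E c hor p = aplam A c p.1) /\
  forall c : chart M,
  let N := nlc E c in
  let G := eap_conn E c in
  let Gcan := G cn_canonical in
  let Lam := torsion_Lambda Gcan in
  let gam := contortion N (lam E c) in
  let gamh := gam hor hor in
  let Curv := fun s => curvature N (G s) in
  let apG := ap_conn (aplam A c) in
  let DLam := cov12 N Gcan hor hor hor hor Lam in
  let Dgam := cov12 N Gcan hor hor hor hor gamh in
  (* (1) *)
  [/\ (forall s k d i j l p, (k, d) <> (hor, hor) -> tdom c p ->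
         G s k d i j l p = Gcan k d i j l p) /\
      (forall s al mu nu,
         x_only c (G s hor hor al mu nu) /\
         lifts c (G s hor hor al mu nu) (apG s al mu nu)),
  (* (2) *)
      (forall al mu nu, x_only c (Lam al mu nu)) /\
      [/\ forall a mu nu, vanishes c (torsion_R N a mu nu),
          forall al mu c', vanishes c (torsion_C Gcan al mu c'),
          forall a mu c', vanishes c (torsion_P N Gcan a mu c')
        & forall a b c', vanishes c (torsion_T Gcan a b c')] /\
      (forall al mu nu, x_only c (gamh al mu nu)) /\
      (forall k d i j l, (k, d) <> (hor, hor) -> vanishes c (gam k d i j l)),
  (* (3) *)
      (forall k d1 d2 i j l m, vanishes c (Curv cn_canonical k d1 d2 i j l m)) /\
      (forall s k d1 d2 i j l m, (k, d1, d2) <> (hor, hor, hor) ->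
         vanishes c (Curv s k d1 d2 i j l m)) /\
      (forall s al be mu nu, x_only c (Curv s hor hor hor al be mu nu)) /\
      (forall al be mu nu p, tdom c p ->
       [/\ Curv cn_natural hor hor hor al be mu nu p =
             (Dgam al be mu nu p - Dgam al be nu mu p)
             + \sum_e (gamh e be nu p * gamh al e mu p
                       - gamh e be mu p * gamh al e nu p)
             + \sum_e gamh al be e p * Lam e mu nu p,
           Curv cn_dual hor hor hor al be mu nu p = DLam al nu mu be p
         & Curv cn_symmetric hor hor hor al be mu nu p =
             2^-1 * (DLam al be mu nu p - DLam al be nu mu p)
             + 4^-1 * \sum_e (Lam e be mu p * Lam al nu e p
                              - Lam e be nu p * Lam al mu e p)
             + 2^-1 * \sum_e Lam e mu nu p * Lam al be e p])
  (* (4), with the lower indices of the last factor in the order e b, as the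
     given conventions require, and the coincidence with the classical AP-space *)
    & exists W : stdconn -> kind -> kind -> kind ->
                 'I_n -> 'I_n -> 'I_n -> 'I_n -> 'rV[R]_n * 'rV[R]_n -> R,
      [/\ forall s k d1 d2,
            is_Wtensor N (lam E c) (tdom c) (G s) k d1 d2 (W s k d1 d2),
          forall al be nu mu,
            x_only c (W cn_dual hor hor hor al be nu mu) /\
            (forall p, tdom c p -> W cn_dual hor hor hor al be nu mu p =
               DLam al nu mu be p + \sum_e Lam e nu mu p * Lam al e be p),
          (forall k d1 d2 i j l m, vanishes c (W cn_canonical k d1 d2 i j l m)) /\
          (forall s k d1 d2 i j l m, (k, d1, d2) <> (hor, hor, hor) ->
             vanishes c (W s k d1 d2 i j l m)) /\
          (forall s al be nu mu p, s = cn_symmetric \/ s = cn_natural ->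
             tdom c p -> W s hor hor hor al be nu mu p =
                         Curv s hor hor hor al be mu nu p)
        & [/\ forall al be, lifts c (metric (lam E c) hor al be)
                                    (ap_metric (aplam A c) al be),
              forall al mu nu, lifts c (Lam al mu nu)
                                       (ap_torsion (aplam A c) al mu nu),
              forall al mu nu, lifts c (gamh al mu nu)
                                       (ap_contortion (aplam A c) al mu nu),
              forall s al be mu nu, lifts c (Curv s hor hor hor al be mu nu)
                                            (bcurvature (apG s) al be mu nu)
            & exists W0 : 'I_n -> 'I_n -> 'I_n -> 'I_n -> 'rV[R]_n -> R,
                is_ap_Wtensor (aplam A c) (cimage c) (apG cn_dual) W0 /\
                forall al be nu mu,
                  lifts c (W cn_dual hor hor hor al be nu mu)
                          (W0 al be nu mu)]]].
Proof.
exists (base_APspace CB); split; first by move=> c p; exact: base_lamE.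
move=> c N G Gcan Lam gam gamh Curv apG DLam Dgam.
pose A := base_lam E c.
have oU : open (cimage c) := @cimage_open _ _ M c.
have sA := smooth_on_base_lam E c; have fA := @base_lam_free _ _ _ E c.
have LA k p (Op : tdom c p) := base_lamE CB k Op.
have NA a mu p (Op : tdom c p) := ncoefE CB a mu Op.
have liftsI f g : lifts_on (U := cimage c) f g -> lifts c f g.
  by move=> fg x y Ux; exact: fg.
have hG s k i j l : lifts_on (U := cimage c) (G s k hor i j l) (base_conn A s k i j l).
  exact: (std_dconn_hor oU sA fA LA NA).
have vG s k i j l p : tdom c p -> G s k ver i j l p = 0.
  exact: (std_dconn_ver oU N LA).
have hLam al mu nu := torsion_Lambda_lift oU sA fA LA NA al mu nu.
have hgam al mu nu := contortion_hor_hor oU sA fA LA NA al mu nu.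
have hCurv s al be mu nu := curvature_hor_hor oU sA fA LA NA s hor al be mu nu.
have hDLam i j1 j2 l := cov12_hor oU sA fA LA NA i j1 j2 l hLam.
have hDgam i j1 j2 l := cov12_hor oU sA fA LA NA i j1 j2 l hgam.
have Curv0 s k d1 d2 i j l m p : (k, d1, d2) <> (hor, hor, hor) -> tdom c p ->
    Curv s k d1 d2 i j l m p = 0.
  case: k => [h|_] Op; last exact: (curvature_ver oU sA fA LA NA).
  apply: (curvature_vanishes oU sA fA LA NA) Op => d12; apply: h.
  by case: d12 => -> ->.
(* By [Wtensor_unique] these values are forced on the chart domain. For the symmetric and natural
   connections [l] and [m] are exchanged in the curvature, because a W-tensor differentiates along
   [l] first. *)
pose W s k d1 d2 i j l m : 'rV[R]_n * 'rV[R]_n -> R :=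
  match k, d1, d2 with
  | hor, hor, hor =>
      match s with
      | cn_canonical => fun=> 0
      | cn_dual => fun p =>
          DLam i l m j p + \sum_e Lam e l m p * Lam i e j p
      | _ => Curv s hor hor hor i j m l
      end
  | _, _, _ => fun=> 0
  end.
pose W0 i j l m x := bcov12 (ap_canonical (A hor)) (ap_torsion (A hor)) i l m j x
  + \sum_e ap_torsion (A hor) e l m x * ap_torsion (A hor) i e j x.
have WW0 al be nu mu : lifts_on (U := cimage c) (W cn_dual hor hor hor al be nu mu)
    (W0 al be nu mu).
  move=> p Op; rewrite /W /W0 [DLam _ _ _ _ _]hDLam//; congr (_ + _).
  by apply: eq_bigr => e _; rewrite [Lam e _ _ _]hLam// [Lam al _ _ _]hLam.
split.
- split=> [s k d i j l p kd Op|s al mu nu].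
    case: d kd => [kd|_]; last by rewrite [LHS]vG// [RHS]vG.
    by rewrite [LHS]hG// [RHS]hG//; case: k kd.
  by split; [apply: lifts_x_only|]; apply: liftsI; exact: hG.
- split; first by move=> al mu nu; apply: lifts_x_only (liftsI _ _ (hLam al mu nu)).
  split.
    split=> [a mu nu p Op|al mu d p Op|a mu d p Op|a b d p Op].
    + exact: (torsion_R_eq0 oU sA fA NA).
    + exact: vG.
    + by rewrite /torsion_P (dy_N oU NA)// [X in _ - X]hG// subrr.
    + by rewrite /torsion_T /Gcan !vG// subrr.
  split; first by move=> al mu nu; apply: lifts_x_only (liftsI _ _ (hgam al mu nu)).
  move=> k d i j l kd p Op.
  rewrite (_ : gam k d i j l p = G cn_canonical k d i j l p - G cn_natural k d i j l p)//.
  case: d kd => [|_]; last by rewrite !vG// subrr.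
  by case: k => // _; rewrite !hG// subrr.
- split.
    move=> k d1 d2 i j l m p Op; case: k; last exact: (curvature_ver oU sA fA LA NA).
    case: d1; last by apply: Curv0.
    case: d2; last by apply: Curv0.
    by rewrite [LHS]hCurv//; exact: (bcurvature_canonical oU (sA hor) (fA hor)).
  split; first by move=> s k d1 d2 i j l m h p; exact: Curv0.
  split.
    by move=> s al be mu nu; apply: lifts_x_only (liftsI _ _ (hCurv s al be mu nu)).
  move=> al be mu nu p Op; split.
  + rewrite [LHS]hCurv// [LHS](bcurvature_levi_civita oU (sA hor) (fA hor))//.
    by rewrite -!hDgam//; congr (_ + _ + _); apply: eq_bigr => e _;
      rewrite -!hgam// -?hLam.
  + by rewrite [LHS]hCurv// [LHS](bcurvature_dual oU (sA hor) (fA hor))// -hDLam.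
  + rewrite [LHS]hCurv// [LHS](bcurvature_symmetric oU (sA hor) (fA hor))//.
    rewrite -!hDLam//; congr (_ + _ * _ + _ * _); apply: eq_bigr => e _;
      by rewrite -!hLam.
- exists W; split.
  + move=> s k d1 d2 r i l m p Op /=.
    have Z : s = cn_canonical \/ (k, d1, d2) <> (hor, hor, hor) ->
        \sum_e lam E c k p r e * W s k d1 d2 i e l m p = 0.
      move=> h; apply: big1 => e _; rewrite (_ : W _ _ _ _ _ _ _ _ _ = 0) ?mulr0//.
      by case: h => [->|]; case: k; case: d1; case: d2.
    have V := Wtensor_vanishes oU sA fA LA NA r i l m (s := s) (k := k)
      (d1 := d1) (d2 := d2) _ Op.
    case: k d1 d2 Z V => [] [] [] Z V; try by rewrite [LHS]V ?Z//; right.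
    rewrite [LHS](Wtensor_hor oU sA fA LA NA s r i l m Op) /=.
    case: s Z V => Z V.
    (* The canonical expression on M is carried back to TM, where [V] says that it vanishes. *)
    * by rewrite Z; [rewrite -[RHS](V (or_introl erefl))
         [RHS](Wtensor_hor oU sA fA LA NA cn_canonical r i l m Op)|left].
    * rewrite (dual_Wtensor oU (sA hor) (fA hor))//; apply: eq_bigr => e _.
      by congr (_ * _); [rewrite LA|exact/esym/WW0].
    * rewrite (torsion_free_Wtensor oU (sA hor) (fA hor)); [|by left|by []].
      by apply: eq_bigr => e _; congr (_ * _); [rewrite LA|exact/esym/hCurv].
    * rewrite (torsion_free_Wtensor oU (sA hor) (fA hor)); [|by right|by []].
      by apply: eq_bigr => e _; congr (_ * _); [rewrite LA|exact/esym/hCurv].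
  + move=> al be nu mu; split=> //.
    exact: lifts_x_only (liftsI _ _ (WW0 al be nu mu)).
  + split; first by move=> [] [] [].
    split; first by move=> s [] [] [] i j l m.
    by move=> s al be nu mu p [] ->.
  + split.
    * by move=> al be; apply: liftsI; exact: (metric_lift LA).
    * by move=> al mu nu; apply: liftsI; exact: hLam.
    * by move=> al mu nu; apply: liftsI; exact: hgam.
    * by move=> s al be mu nu; apply: liftsI; exact: hCurv.
    * exists W0; split; last by move=> al be nu mu; apply: liftsI; exact: WW0.
      move=> r al nu mu x Ux /=.
      by rewrite (dual_Wtensor oU (sA hor) (fA hor)).
Qed.
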